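(* Let $E\in\mathcal M(I_0,\{n_k\},\{c_k\})$ be a homogeneous Moran set. Suppose there are two nonnegative real sequences $\{L_k\}_{k\ge1}$ and $\{R_k\}_{k\ge1}$ such that $\xi_{\sigma,0}=L_{k+1}$ and $\xi_{\sigma,n_{k+1}}=R_{k+1}$ for all $k\ge0$ and all $\sigma\in D_k$. Assume moreover that there are constants $w_1,w_2>0$, independent of $k$, such that for any $k\ge1$ at least one of the following two conditions holds: (A) $\overline\nu_k\le w_1\delta_k$; (B) $\overline\nu_k\le w_2\,\underline\nu_k$. If $\dim_PE=1$, then $\dim_Pf(E)=1$ for every $1$-dimensional quasisymmetric mapping $f$; hence $E$ is a quasisymmetrically packing-minimal set.
   Context: $\dim_P$ is packing dimension; $|A|$ denotes the diameter of $A\subset\mathbb R$. Quasisymmetric mappings. A homeomorphism $f:\mathbb R\to\mathbb R$ is a $1$-dimensional quasisymmetric mapping if there is a homeomorphism $\eta:[0,\infty)\to[0,\infty)$ such that $\frac{|f(x)-f(a)|}{|f(x)-f(b)|}\le\eta\left(\frac{|x-a|}{|x-b|}\right)$ for all triples $a,b,x$ of distinct points of $\mathbb R$. A set $E\subset\mathbb R$ is quasisymmetrically packing-minimal if $\dim_Pf(E)\ge\dim_PE$ for every $1$-dimensional quasisymmetric mapping $f$. Homogeneous Moran sets. Let $\{n_k\}_{k\ge1}$ be integers with $n_k\ge2$ and $\{c_k\}_{k\ge1}$ positive reals with $n_kc_k<1$. Let $D_k=\{i_1\cdots i_k:1\le i_j\le n_j,\ 1\le j\le k\}$ for $k\ge1$,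 let $D_0$ consist of the empty word $\emptyset$ only, and $D=\bigcup_{k\ge0}D_k$; $\sigma*l$ denotes concatenation. Let $I_0=[0,1]$. A family $\{I_\sigma:\sigma\in D\}$ of closed subintervals of $I_0$ has homogeneous Moran structure if: (1) $I_\emptyset=I_0$; (2) for $k\ge1$, $\sigma\in D_{k-1}$, the intervals $I_{\sigma*1},\dots,I_{\sigma*n_k}$ are closed subintervals of $I_\sigma$ with $\min I_{\sigma*(l+1)}\ge\max I_{\sigma*l}$ for $1\le l\le n_k-1$; (3) $|I_{\sigma*i}|/|I_\sigma|=c_k$ for all $k\ge1$, $\sigma\in D_{k-1}$, $1\le i\le n_k$. Then $E=\bigcap_{k\ge0}\bigcup_{\sigma\in D_k}I_\sigma$ is called a homogeneous Moran set, and $\mathcal M(I_0,\{n_k\},\{c_k\})$ is the class of all such sets (each considered together with its family of intervals). Notation. For $k\ge1$, $\sigma\in D_{k-1}$, $1\le i\le n_k-1$: $\xi_{\sigma,0}=\min I_{\sigma*1}-\min I_\sigma$, $\xi_{\sigma,i}=\min I_{\sigma*(i+1)}-\max I_{\sigma*i}$, $\xi_{\sigma,n_k}=\max I_\sigma-\max I_{\sigma*n_k}$. Further $\overline\nu_k=\max_{\sigma\in D_{k-1},1\le i\le n_k-1}\xi_{\sigma,i}$, $\underline\nu_k=\min_{\sigma\in D_{k-1},1\le i\le n_k-1}\xi_{\sigma,i}$, and $\delta_k=\prod_{i=1}^kc_i$ (with $\delta_0=1$), the common length of the $I_\sigma$, $\sigma\in D_k$. *)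

(* Defs.v *)
From HB Require Import structures.
From mathcomp Require Export all_boot all_order all_algebra.
From mathcomp Require Export all_classical all_reals all_analysis.
Export numFieldNormedType.Exports.
Export Order.TTheory GRing.Theory Num.Theory.

Set Implicit Arguments.
Unset Strict Implicit.
Unset Printing Implicit Defensive.

Local Open Scope classical_set_scope.
Local Open Scope ring_scope.

Section PackingDimension.
Context {R : realType}.
Implicit Types (s d : R) (F : set R).

(* A packing is a set of pairs (center, radius).  Its balls have positive
   radius and are pairwise disjoint, so it is automatically countable. *)
Definition is_packing d F (P : set (R * R)) : Prop :=
  (forall p, P p -> [/\ F p.1, 0 < p.2 & p.2 <= d]) /\
  trivIset P (fun p => closed_ball p.1 p.2).

(* [2 * p.2] is the diameter of the ball. *)
Definition packing_sum s (P : set (R * R)) : \bar R :=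
  (\esum_(p in P) ((2 * p.2) `^ s)%:E)%E.

Definition packing_content s d F : \bar R :=
  ereal_sup [set packing_sum s P | P in is_packing d F].

Definition packing_premeasure s F : \bar R :=
  lim (packing_content s d F @[d --> 0^'+]).

Definition packing_measure s F : \bar R :=
  ereal_inf [set (\sum_(0 <= i <oo) packing_premeasure s (G i))%E
            | G in [set G : (set R)^nat | F `<=` \bigcup_i G i]].

Definition packing_dim F : \bar R :=
  ereal_inf [set s%:E | s in [set s : R | 0 <= s /\ packing_measure s F = 0%E]].

End PackingDimension.

Definition homeomorphism_between (T U : topologicalType)
    (A : set T) (B : set U) (f : T -> U) : Prop :=
  exists g : U -> T,
    [/\ (forall x, A x -> B (f x)) /\ (forall y, B y -> A (g y)),
        forall x, A x -> g (f x) = x,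
        forall y, B y -> f (g y) = y,
        {within A, continuous f} &
        {within B, continuous g}].

Section Quasisymmetric.
Context {R : realType}.

Definition quasisymmetric (f : R -> R) : Prop :=
  homeomorphism_between [set: R] [set: R] f /\
  exists eta : R -> R,
    homeomorphism_between
      (`[0, +oo[%classic : set R) (`[0, +oo[%classic : set R) eta /\
    forall a b x : R, a != b -> a != x -> b != x ->
      `|f x - f a| / `|f x - f b| <= eta (`|x - a| / `|x - b|).

Definition qs_packing_minimal (E : set R) : Prop :=
  forall f : R -> R, quasisymmetric f ->
    (packing_dim E <= packing_dim (f @` E))%E.

End Quasisymmetric.

(* Words are 1-based: their letters satisfy 1 <= i_j <= n_j.  The sequences n
   and c below are used only at indices k >= 1; their value at 0 is ignored.
   Concatenation sigma * l is [rcons sigma l]. *)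
Definition words (n : nat -> nat) (k : nat) : set (seq nat) :=
  [set sigma | size sigma = k /\
    forall j, (j < k)%N -> (1 <= nth 0%N sigma j <= n j.+1)%N].

Section HomogeneousMoran.
Context {R : realType}.

(* The interval I_sigma is [lo sigma, hi sigma]. *)
Variables (n : nat -> nat) (c : nat -> R) (lo hi : seq nat -> R).

Definition moran_structure : Prop :=
  [/\ lo [::] = 0 /\ hi [::] = 1,
      forall k sigma i, (1 <= k)%N -> words n k.-1 sigma -> (1 <= i <= n k)%N ->
        [/\ lo sigma <= lo (rcons sigma i),
            lo (rcons sigma i) <= hi (rcons sigma i) &
            hi (rcons sigma i) <= hi sigma],
      forall k sigma l, (1 <= k)%N -> words n k.-1 sigma ->
        (1 <= l <= (n k).-1)%N ->
        hi (rcons sigma l) <= lo (rcons sigma l.+1) &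
      forall k sigma i, (1 <= k)%N -> words n k.-1 sigma -> (1 <= i <= n k)%N ->
        (hi (rcons sigma i) - lo (rcons sigma i)) / (hi sigma - lo sigma)
          = c k].

Definition moran_set : set R :=
  \bigcap_(k in [set: nat]) \bigcup_(sigma in words n k)
    `[lo sigma, hi sigma]%classic.

(* The gap xi_{sigma,i}, meaningful for 0 <= i <= n_k with k = |sigma| + 1. *)
Definition gap (sigma : seq nat) (i : nat) : R :=
  if i == 0%N then lo (rcons sigma 1%N) - lo sigma
  else if i == n (size sigma).+1 then hi sigma - hi (rcons sigma i)
  else lo (rcons sigma i.+1) - hi (rcons sigma i).

Definition inner_gaps (k : nat) : set R :=
  [set gap p.1 p.2 | p in
    [set p : seq nat * nat | words n k.-1 p.1 /\ (1 <= p.2 <= (n k).-1)%N]].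

(* [inner_gaps k] is finite, and nonempty when all n_j >= 2, so these are its
   maximum and minimum. *)
Definition nu_max (k : nat) : R := sup (inner_gaps k).
Definition nu_min (k : nat) : R := inf (inner_gaps k).

Definition delta (k : nat) : R := \prod_(1 <= i < k.+1) c i.

End HomogeneousMoran.

(* Main.v *)
(* A quasisymmetric map of the line is, up to a reflection, an increasing doubling
   function [g].  Let [N_k] be the number of intervals of level [k], [h_k] the common
   length of the convex hull of the children of such an interval, and
   [rho_k = h_k / n_(k+1)].  Sorting the balls of a packing of [E] according to the
   [k] such that [rho_(k+1) < r <= rho_k] shows that [dim_P E = 1] forces
   [N_k h_k >= rho_k ^ e] for infinitely many [k], whatever [e > 0].

   Conditions (A) and (B) both say that the children of an interval are evenly spaced
   up to a constant.  Hence the [g]-lengths of the [n] children of ratio [c] add up to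
   at least [n ^ (- eta) * (n c) ^ Q] times that of the parent, with [eta > 0]
   arbitrarily small and [Q = Q(eta)]: doubling gives this for large [n]; for bounded
   [n], either [n c] is close to 1, so that every gap is short and has a small [g]-length,
   or [n c] is bounded away from 1 and a large [Q] suffices.  By multiplication, the
   images of the cells of level [k + 1] carry disjoint balls centred in [f(E)] whose radii
   sum up to at least [rho_k ^ o(1)], while [g] is Hoelder continuous of some exponent
   [p], so that every radius is at most [C rho_k ^ p].  For [s < 1] the sum of the
   [r ^ s] is therefore unbounded, inside any cell, and a Baire category argument
   transfers this to the packing measure. *)
Require Import Defs.
From mathcomp Require Import ring lra zify.

Set Implicit Arguments.
Unset Strict Implicit.
Unset Printing Implicit Defensive.

Local Open Scope classical_set_scope.
Local Open Scope ring_scope.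

Ltac nat_lia :=
  repeat match goal with
  | h : is_true (@Order.le _ _ _ _) |- _ => clear h
  | h : is_true (@Order.lt _ _ _ _) |- _ => clear h
  | h : @eq (Real.sort _) _ _ |- _ => clear h
  | h : forall _, _ |- _ => clear h
  end; lia.

(** * Doubling functions *)

(** The exponent is the integer part of the logarithm of [t] in base [b]; it discretizes a ratio of
    lengths. *)
Lemma expr_bracket {R : realType} (b t : R) : 1 < b -> 1 <= t ->
  exists m : nat, b ^+ m <= t < b ^+ m.+1.
Proof.
move=> b1 t1; have b0 : 0 < b by lra.
have t0 : 0 < t by lra.
have lb : 0 < ln b by exact: ln_gt0.
have lt : 0 <= ln t by exact: ln_ge0.
have /andP[h1 h2] : (Num.truncn (ln t / ln b))%:R <= ln t / ln b
    < (Num.truncn (ln t / ln b)).+1%:R by apply: truncn_itv; exact: divr_ge0 (ltW lb).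
exists (Num.truncn (ln t / ln b)).
move: h1 h2; rewrite ler_pdivlMr// ltr_pdivrMr// => h1 h2.
have bE k : b ^+ k = expR (k%:R * ln b) by rewrite mulrC expRM_natr lnK.
have tE : t = expR (ln t) by rewrite lnK.
by rewrite !bE; apply/andP; split; [rewrite [leRHS]tE ler_expR|rewrite [ltLHS]tE ltr_expR].
Qed.

(** Turns a factor [a] per change of scale by [b] into a power law of exponent [ln a / ln b]. *)
Lemma powR_exprn {R : realType} (a b : R) (m : nat) : 0 < a -> 1 < b ->
  (b ^+ m) `^ (ln a / ln b) = a ^+ m.
Proof.
move=> a0 b1; have lb : 0 < ln b by exact: ln_gt0.
have b0 : 0 < b by lra.
rewrite -powR_mulrn ?(ltW b0)// -powRrM /powR gt_eqF//.
have -> : m%:R * (ln a / ln b) * ln b = ln a * m%:R by field; rewrite gt_eqF.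
by rewrite expRM_natr lnK.
Qed.

(** For an increasing homeomorphism of the line this is the Beurling-Ahlfors condition; here [g] is
    only required to be nondecreasing. *)
Definition doubling {R : realType} (H : R) (g : R -> R) : Prop :=
  [/\ 1 <= H, {homo g : x y / x <= y} &
      forall x h, 0 < h -> g (x + h) - g x <= H * (g x - g (x - h)) /\
                           g x - g (x - h) <= H * (g (x + h) - g x)].

Section Doubling.
Context {R : realType} (g : R -> R) (H : R).

(** As long as [[x, y]] occupies at most a third of [[u, v]], an adjacent interval of the same
    length fits on one side. Adjoining it gains a factor [H / (1 + H)] in the image and only doubles
    the length, so one power of 3 pays for it. *)
Lemma doubling_shrink m (u v x y : R) : doubling H g -> u <= x -> x <= y -> y <= v ->
  3 ^+ m * (y - x) <= v - u ->
  g y - g x <= (H / (1 + H)) ^+ m * (g v - g u).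
Proof.
move=> [H1 g_homo g_dbl]; elim: m u v x y => [|m IH] u v x y ux xy yv.
  by move=> _; rewrite mul1r; apply: lerB; apply: g_homo.
have lam0 : 0 <= H / (1 + H) by apply: divr_ge0; lra.
have guv : g u <= g v by apply: g_homo; lra.
move: xy; rewrite le_eqVlt => /orP[/eqP <-|xy] hm.
  by rewrite subrr mulr_ge0 ?exprn_ge0 ?subr_ge0.
have e3 : 3 ^+ m * (y - x + (y - x)) <= v - u.
  apply: le_trans hm; rewrite exprSr -mulrA ler_wpM2l ?exprn_ge0//; lra.
have p3 : 1 <= 3 ^+ m :> R by rewrite exprn_ege1//; lra.
have key a b : a <= H * b -> a <= H / (1 + H) * (a + b).
  by move=> ab; rewrite mulrAC ler_pdivlMr; lra.
have [dl dr] := @g_dbl x (y - x) ltac:(lra).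
have [el er] := @g_dbl y (y - x) ltac:(lra).
rewrite exprS -mulrA.
have [ux'|ux'] := lerP u (x - (y - x)).
- have := IH u v (x - (y - x)) y ux' ltac:(lra) yv.
  have -> : y - (x - (y - x)) = y - x + (y - x) by ring.
  move=> /(_ e3) h; apply: le_trans (ler_wpM2l lam0 h).
  have -> : g y - g (x - (y - x)) = (g y - g x) + (g x - g (x - (y - x))) by ring.
  apply: key; move: dl; have -> // : x + (y - x) = y by ring.
- have h3 : 3 * (y - x) <= 3 ^+ m.+1 * (y - x).
    by rewrite exprS -mulrA ler_pM2l// ler_peMl//; lra.
  have := IH u v x (y + (y - x)) ux ltac:(lra) ltac:(lra).
  have -> : y + (y - x) - x = y - x + (y - x) by ring.
  move=> /(_ e3) h; apply: le_trans (ler_wpM2l lam0 h).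
  have -> : g (y + (y - x)) - g x = (g y - g x) + (g (y + (y - x)) - g y) by ring.
  apply: key; move: er; have -> // : y - (y - x) = x by ring.
Qed.

(** One step adjoins a copy of [[x, y]] on each side, which multiplies the image by at most
    [1 + 2 * H]. The margins still to be covered are then at most [2 * (2 ^ m - 1) * (y - x)],
    within what the induction allows for an interval of length [3 * (y - x)]. *)
Lemma doubling_expand m (u v x y : R) : doubling H g -> x < y ->
  x - u <= (2 ^+ m - 1) * (y - x) -> v - y <= (2 ^+ m - 1) * (y - x) ->
  g v - g u <= (1 + 2 * H) ^+ m * (g y - g x).
Proof.
move=> [H1 g_homo g_dbl]; elim: m u v x y => [|m IH] u v x y xy.
  rewrite expr0 subrr mul0r mul1r => h1 h2.
  by apply: lerB; apply: g_homo; lra.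
move=> h1 h2.
have p2 : 1 <= 2 ^+ m :> R by rewrite exprn_ege1//; lra.
have [_ dr] := @g_dbl x (y - x) ltac:(lra).
have [el _] := @g_dbl y (y - x) ltac:(lra).
move: dr el.
have -> : x + (y - x) = y by ring.
have -> : y - (y - x) = x by ring.
move=> dr el.
have h : g v - g u <= (1 + 2 * H) ^+ m * (g (y + (y - x)) - g (x - (y - x))).
  move: h1 h2; rewrite exprS => h1 h2.
  have h0 : 0 <= (2 ^+ m - 1) * (y - x) by rewrite mulr_ge0//; lra.
  apply: IH; nra.
apply: le_trans h _; rewrite exprSr -mulrA ler_wpM2l//.
  by rewrite exprn_ge0//; lra.
lra.
Qed.

(** [doubling_shrink] is applied inside [[-1, 2]], which leaves room for steps of length 1 beyond
    [[0, 1]]. *)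
Lemma doubling_holder : doubling H g -> exists p C : R, [/\ 0 < p, 0 < C &
  forall x y : R, -1 <= x -> x <= y -> y <= 2 -> g y - g x <= C * (y - x) `^ p].
Proof.
move=> hg; have [H1 g_homo _] := hg.
have lam0 : 0 < H / (1 + H) by apply: divr_gt0; lra.
have lam1 : H / (1 + H) < 1 by rewrite ltr_pdivrMr; lra.
have g12 : g (-1) <= g 2 by apply: g_homo; lra.
(* The exponent is positive because [H / (1 + H) < 1]; the [+ 1] keeps the constant positive even if
   [g] is constant on [[-1, 2]]. *)
exists (- (ln (H / (1 + H)) / ln 3)), (g 2 - g (-1) + 1).
have l3 : 0 < ln 3 :> R by apply: ln_gt0; lra.
have ll : ln (H / (1 + H)) < 0 by rewrite ln_lt0// lam0.
split; [|lra|].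
  by rewrite oppr_gt0 pmulr_llt0 ?invr_gt0.
move=> x y x1; rewrite le_eqVlt => /orP[/eqP <-|xy] y2.
  by rewrite subrr mulr_ge0 ?powR_ge0//; lra.
have l0 : 0 < y - x by lra.
have [|m /andP[m1 m2]] := @expr_bracket R 3 (3 / (y - x)) ltac:(lra).
  by rewrite ler_pdivlMr//; lra.
move: m1; rewrite ler_pdivlMr// => m1.
have := @doubling_shrink m (-1) 2 x y hg x1 (ltW xy) y2 ltac:(lra).
move=> h; apply: (le_trans h); rewrite mulrC; apply: ler_pM.
- by lra.
- by rewrite exprn_ge0// ltW.
- by lra.
rewrite -(@powR_exprn R (H / (1 + H)) 3 m)//; last by lra.
set p := - (ln (H / (1 + H)) / ln 3); have -> : ln (H / (1 + H)) / ln 3 = - p by rewrite opprK.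
have p0 : 0 <= p by rewrite oppr_ge0 pmulr_lle0 ?invr_gt0// ltW.
rewrite powRN -[leLHS]mul1r ler_pdivrMr ?powR_gt0 ?exprn_gt0// -powRM ?exprn_ge0 ?(ltW l0)//.
have e1 : 1 `^ p = 1 :> R by rewrite powR1.
rewrite -[leLHS]e1.
apply: ge0_ler_powR; rewrite ?nnegrE ?mulr_ge0 ?exprn_ge0 ?(ltW l0)//.
by move: m2; rewrite exprS ltr_pdivrMr// => m2; nra.
Qed.

Lemma doubling_lower : doubling H g -> exists q C : R, [/\ 0 < q, 1 <= C &
  forall T u v x y : R, x < y -> y - x <= T -> x - T <= u -> v <= y + T ->
    g v - g u <= C * (T / (y - x)) `^ q * (g y - g x)].
Proof.
move=> hg; have [H1 g_homo _] := hg.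
have l2 : 0 < ln 2 :> R by apply: ln_gt0; lra.
have q0 : 0 < ln (1 + 2 * H) / ln 2.
  by rewrite divr_gt0// ln_gt0//; lra.
exists (ln (1 + 2 * H) / ln 2), (4 `^ (ln (1 + 2 * H) / ln 2)); split => //.
  by rewrite -[leLHS](powRr0 4) ler_powR ?(ltW q0)//; lra.
move=> T u v x y xy xyT Tu Tv.
have l0 : 0 < y - x by lra.
have gxy : g x <= g y by apply: g_homo; lra.
have t1 : 1 <= T / (y - x) by rewrite ler_pdivlMr//; lra.
(* With [t = T / (y - x)], the [+ 1] gives [t <= 2 ^ m.+1 - 1], which covers the margins, while
   [2 ^ m.+1 <= 2 * (t + 1) <= 4 * t] explains the constant [4 ^ q]. *)
have [|m /andP[m1 m2]] := @expr_bracket R 2 (T / (y - x) + 1) ltac:(lra).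
  by lra.
have TE : T = T / (y - x) * (y - x) by rewrite divfK// gt_eqF.
set t := T / (y - x) in t1 m1 m2 TE *.
apply: le_trans (@doubling_expand m.+1 u v x y hg xy _ _) _.
- by apply: (@le_trans _ _ T); [lra|rewrite {1}TE ler_pM2r//; lra].
- by apply: (@le_trans _ _ T); [lra|rewrite {1}TE ler_pM2r//; lra].
apply: ler_wpM2r; first by lra.
rewrite -(@powR_exprn R (1 + 2 * H) 2 m.+1); [|lra|lra].
rewrite -powRM; [|lra|lra].
apply: ge0_ler_powR; rewrite ?nnegrE ?(ltW q0) ?exprn_ge0//; first lra.
rewrite exprS; lra.
Qed.

End Doubling.

(** * Image lengths of evenly spaced children *)

Lemma powR_invl {R : realType} (a x : R) : 0 < a -> a^-1 `^ x = (a `^ x)^-1.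
Proof. by move=> a0; rewrite -(powR_inv1 (ltW a0)) -powRrM mulN1r powRN. Qed.

(** [a i] is the left endpoint of the [i]-th child. The last clause is what remains of (A) and (B):
    a step between siblings is at most [2 * w] times [(v - u) / n]. *)
Definition spaced_children {R : realType} (w u v c : R) (n : nat) (a : nat -> R) : Prop :=
  [/\ (2 <= n)%N, u < v, 0 < c & n%:R * c < 1] /\
  [/\ u <= a 1%N, a n + c * (v - u) <= v &
      forall i, (1 <= i < n)%N -> a i + c * (v - u) <= a i.+1 /\
                                  (a i.+1 - a i) * n%:R <= 2 * w * (v - u)].

Definition image_sum {R : realType} (g : R -> R) (u v c : R) (n : nat) (a : nat -> R) : R :=
  \sum_(1 <= i < n.+1) (g (a i + c * (v - u)) - g (a i)).

Section Children.
Context {R : realType} (g : R -> R) (H w : R).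

Lemma spaced_children_length (u v c : R) n a : spaced_children w u v c n a ->
  n%:R * c * (v - u) <= a n + c * (v - u) - a 1%N.
Proof.
move=> [[n2 uv c0 nc1] [ua av ha]].
have := telescope_sumr a (ltnW n2).
have : \sum_(1 <= i < n) (c * (v - u)) <= \sum_(1 <= i < n) (a i.+1 - a i).
  by rewrite !big_nat; apply: ler_sum => i /ha [h _]; lra.
rewrite sumr_const_nat => h1 h2; move: h1; rewrite h2 -[_ *+ (n - 1)]mulr_natl natrB ?(ltnW n2)//.
nra.
Qed.

(** A child fills a proportion at least [n c / (2 w)] of the bound on the step to its successor, and
    the hull of the children a proportion at least [n c] of the parent. Each comparison costs a
    factor [(n c) ^ q] by [doubling_lower], whence the exponent [q + q]. *)
Lemma spaced_children_coarse : doubling H g -> 1 <= w ->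
  exists q C : R, [/\ 0 < q, 1 <= C &
  forall u v c n a, spaced_children w u v c n a ->
    (n%:R * c) `^ q * (g v - g u) <= C * image_sum g u v c n a].
Proof.
move=> hg w1; have [H1 g_homo _] := hg.
have [q [C [q0 C1 hlow]]] := doubling_lower hg.
have ww : 1 <= (2 * w) `^ q by rewrite -[leLHS](powRr0 (2 * w)) ler_powR ?(ltW q0)//; lra.
exists (q + q), (C * C * (2 * w) `^ q); split; [lra|nra|].
move=> u v c n a ha; have len := spaced_children_length ha.
have [[n2 uv c0 nc1] [ua av hstep]] := ha.
have l0 : 0 < v - u by lra.
have n0 : 0 < n%:R :> R by rewrite ltr0n; nat_lia.
set t := n%:R * c in nc1 len *.
have t0 : 0 < t by rewrite mulr_gt0.
have tq0 : 0 < t `^ q by rewrite powR_gt0.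
have tq1 : t `^ q <= 1 by rewrite -[leRHS](powRr0 t) ger_powR ?(ltW q0) ?t0 ?ltW.
have S0 i : 0 <= g (a i + c * (v - u)) - g (a i).
  by rewrite subr_ge0; apply: g_homo; nra.
have gap i : (1 <= i < n)%N -> t `^ q * (g (a i.+1) - g (a i)) <=
     C * (2 * w) `^ q * (g (a i + c * (v - u)) - g (a i)).
  move=> /hstep [h1 h2].
  have cv : 0 < c * (v - u) by rewrite mulr_gt0.
  have hT : a i.+1 - a i <= 2 * w * (v - u) / n%:R by rewrite ler_pdivlMr.
  have cT : c * (v - u) <= 2 * w * (v - u) / n%:R.
    by rewrite ler_pdivlMr// mulrAC ler_pM2r// mulrC -/t; lra.
  have h := hlow (2 * w * (v - u) / n%:R) (a i) (a i.+1) (a i) (a i + c * (v - u))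
    ltac:(lra) ltac:(lra) ltac:(lra) ltac:(lra).
  rewrite -(ler_pdivlMl _ _ tq0); apply: (le_trans h).
  rewrite le_eqVlt; apply/orP; left; apply/eqP.
  have -> : 2 * w * (v - u) / n%:R / (a i + c * (v - u) - a i) = 2 * w * t^-1.
    by rewrite /t; field; rewrite !gt_eqF//; lra.
  rewrite powRM ?invr_ge0 ?(ltW t0)//; last by lra.
  rewrite powR_invl//; field.
  by rewrite gt_eqF.
have whole : t `^ q * (g v - g u) <= C * (g (a n + c * (v - u)) - g (a 1%N)).
  have tl : 0 < t * (v - u) by rewrite mulr_gt0.
  have h := hlow (v - u) u v (a 1%N) (a n + c * (v - u))
    ltac:(lra) ltac:(lra) ltac:(lra) ltac:(lra).
  rewrite -(ler_pdivlMl _ _ tq0); apply: (le_trans h).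
  rewrite mulrA; apply: ler_wpM2r.
    by rewrite subr_ge0; apply: g_homo; lra.
  rewrite mulrC; apply: ler_wpM2r; first lra.
  rewrite -powR_invl//.
  apply: ge0_ler_powR; rewrite ?nnegrE ?(ltW q0) ?invr_ge0 ?(ltW t0)//.
    by apply: divr_ge0; lra.
  rewrite ler_pdivrMr; last by lra.
  by rewrite mulrC ler_pdivlMr// mulrC.
have sumS : t `^ q * (g (a n + c * (v - u)) - g (a 1%N)) <=
    C * (2 * w) `^ q * image_sum g u v c n a.
  rewrite /image_sum big_nat_recr ?(ltnW n2)//=.
  have -> : g (a n + c * (v - u)) - g (a 1%N) =
    \sum_(1 <= i < n) (g (a i.+1) - g (a i)) + (g (a n + c * (v - u)) - g (a n)).
    by rewrite (telescope_sumr (g \o a)) ?(ltnW n2)//=; ring.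
  rewrite mulrDr [leRHS]mulrDr; apply: lerD.
    by rewrite !mulr_sumr !big_nat; apply: ler_sum.
  by apply: ler_wpM2r; [exact: S0|nra].
rewrite powRD; last by rewrite (gt_eqF t0) implybT.
rewrite -mulrA; apply: (@le_trans _ _ (t `^ q * (C * (g (a n + c * (v - u)) - g (a 1%N))))).
  by rewrite ler_pM2l.
by rewrite mulrCA -!mulrA ler_pM2l ?mulrA//; lra.
Qed.

(** The children and the [n + 1] gaps, outer ones included, fill the parent. A gap is at most
    [3 ^ (- m)] times as long as the parent, so [doubling_shrink] bounds its share of the image. *)
Lemma spaced_children_fine m u v c n a : doubling H g -> spaced_children w u v c n a ->
  3 ^+ m * (1 - n%:R * c) <= 1 ->
  (1 - n.+1%:R * (H / (1 + H)) ^+ m) * (g v - g u) <= image_sum g u v c n a.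
Proof.
move=> hg ha h3; have len := spaced_children_length ha.
have [[n2 uv c0 nc1] [ua av hstep]] := ha.
have [H1 g_homo _] := hg.
have n1 : 1 <= n%:R :> R by rewrite ler1n; nat_lia.
set L := c * (v - u) in av hstep *.
have L0 : 0 < L by rewrite mulr_gt0// subr_gt0.
have nL : n%:R * L <= v - u by rewrite /L mulrA ler_piMl//; lra.
set e := (H / (1 + H)) ^+ m.
have shrink x y : u <= x -> x <= y -> y <= v -> y - x <= (1 - n%:R * c) * (v - u) ->
    g y - g x <= e * (g v - g u).
  move=> ux xy yv yx; apply: doubling_shrink => //.
  apply: (@le_trans _ _ (3 ^+ m * ((1 - n%:R * c) * (v - u)))).
    by rewrite ler_pM2l// exprn_gt0.
  by rewrite mulrA ler_piMl//; lra.
have tel := telescope_sumr a (ltnW n2).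
have gtel := telescope_sumr (g \o a) (ltnW n2).
have aS i : (1 <= i < n)%N -> L <= a i.+1 - a i by move=> /hstep[h _]; lra.
(* The total length of the gaps is [(1 - n c)(v - u)], so every single gap is at most that. *)
have a_mono i j : (1 <= i)%N -> (i <= j)%N -> (j <= n)%N -> (j - i)%:R * L <= a j - a i.
  move=> i1; elim: j => [|j IH]; first by nat_lia.
  rewrite leq_eqVlt => /orP[/eqP<- _|ij jn]; first by rewrite subnn mul0r subrr.
  have := IH ltac:(nat_lia) ltac:(nat_lia); have := aS j ltac:(nat_lia).
  by rewrite subSn// -natr1; lra.
have u_i i : (1 <= i <= n)%N -> u + i.-1%:R * L <= a i.
  by move=> hi; have := @a_mono 1%N i isT ltac:(nat_lia) ltac:(nat_lia); rewrite subn1; lra.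
have v_i i : (1 <= i <= n)%N -> a i <= v - (n - i).+1%:R * L.
  move=> hi; have := @a_mono i n ltac:(nat_lia) ltac:(nat_lia) (leqnn n).
  by rewrite -natr1; lra.
have gap i : (1 <= i < n)%N -> g (a i.+1) - g (a i + L) <= e * (g v - g u).
  move=> hi; have hL := aS i hi.
  have h1 := u_i i ltac:(nat_lia); have h2 := v_i i.+1 ltac:(nat_lia).
  have p1 : 0 <= i.-1%:R * L by rewrite mulr_ge0// ltW.
  have p2 : 0 <= (n - i.+1).+1%:R * L by rewrite mulr_ge0// ltW.
  apply: shrink; [lra|lra|lra|].
  have nE : n%:R = i.-1%:R + (n - i.+1).+1%:R + 1 :> R.
    by rewrite -natrD natr1; congr (_%:R); nat_lia.
  suff : n%:R * L = n%:R * c * (v - u) by rewrite nE; nra.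
  by rewrite /L mulrA.
have g0 : g (a 1%N) - g u <= e * (g v - g u).
  have := v_i 1%N ltac:(nat_lia); rewrite subn1 prednK ?(ltnW n2)// => hv.
  have : n%:R * L = n%:R * c * (v - u) by rewrite /L mulrA.
  have p1 : 0 <= n%:R * L by rewrite mulr_ge0// ltW.
  by move=> hL; apply: shrink => //; lra.
have gn : g v - g (a n + L) <= e * (g v - g u).
  have := u_i n ltac:(nat_lia) => hu.
  have : n%:R * L = n%:R * c * (v - u) by rewrite /L mulrA.
  have nE : n%:R = n.-1%:R + 1 :> R by rewrite natr1; congr (_%:R); nat_lia.
  have p1 : 0 <= n.-1%:R * L by rewrite mulr_ge0// ltW.
  by rewrite {1}nE mulrDl mul1r => hL; apply: shrink; lra.
have gsum : \sum_(1 <= i < n) (g (a i.+1) - g (a i + L)) <= n.-1%:R * (e * (g v - g u)).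
  have -> : n.-1%:R * (e * (g v - g u)) = \sum_(1 <= i < n) (e * (g v - g u)).
    by rewrite sumr_const_nat subn1 mulr_natl.
  by rewrite !big_nat; apply: ler_sum.
have : image_sum g u v c n a = g (a n + L) - g (a 1%N) -
    \sum_(1 <= i < n) (g (a i.+1) - g (a i + L)).
  rewrite /image_sum big_nat_recr ?(ltnW n2)//=.
  rewrite (_ : g (a n + L) - g (a 1%N) = (g (a n + L) - g (a n)) + (g (a n) - g (a 1%N))); last by ring.
  rewrite -gtel -addrA -sumrB addrC; congr (_ + _).
  by apply: eq_bigr => i _ /=; ring.
move=> ->.
have nE : n.+1%:R = n.-1%:R + 2 :> R by rewrite -natrD; congr (_%:R); nat_lia.
rewrite nE mulrBl mul1r mulrDl mulrDl -!mulrA; lra.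
Qed.

(** This inequality will be multiplied over all levels, so no constant factor is tolerated: the
    constant [C] of the coarse bound is absorbed either by [n ^ (- eta)] or by a power of [n c], and
    elsewhere the fine bound is used. *)
Lemma spaced_children_lower eta : doubling H g -> 1 <= w -> 0 < eta ->
  exists Q : R, 0 < Q /\ forall u v c n a, spaced_children w u v c n a ->
    n%:R `^ (- eta) * (n%:R * c) `^ Q * (g v - g u) <= image_sum g u v c n a.
Proof.
move=> hg w1 eta0; have [H1 g_homo _] := hg.
have [q [C [q0 C1 hcoarse]]] := spaced_children_coarse hg w1.
(* From [n >= M] on, [n ^ (- eta) <= 1 / C]. *)
set M := C `^ eta^-1.
have M0 : 0 <= M by exact: powR_ge0.
have l2 : 2 `^ (- eta) < 1 :> R.
  by rewrite powRN invf_lt1 ?powR_gt0// -[ltLHS](powRr0 2) /powR !gt_eqF// ltr_expR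
    ltr_pM2r// ln_gt0// ltr1n.
have lam0 : 0 < H / (1 + H) by apply: divr_gt0; lra.
have lam1 : 1 < (H / (1 + H))^-1 by rewrite invf_gt1// ltr_pdivrMr; lra.
(* For [n < M] the [n + 1] gaps must take at most the share [1 - 2 ^ (- eta)] of the image; this
   fixes the depth [m.+1]. *)
have [|m /andP[_ hm]] := @expr_bracket R _ ((M + 1) / (1 - 2 `^ (- eta))) lam1.
  rewrite ler_pdivlMr; last by lra.
  have := powR_ge0 (2 : R) (- eta); lra.
have {}hm : (M + 1) * (H / (1 + H)) ^+ m.+1 <= 1 - 2 `^ (- eta).
  move: hm; rewrite exprVn ltr_pdivrMr; last by lra.
  by rewrite mulrC ltr_pdivlMr ?exprn_gt0// => /ltW.
set z : R := 1 - (3 ^+ m.+1)^-1.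
have p3 : 1 < 3 ^+ m.+1 :> R by rewrite exprn_egt1//; lra.
have z01 : 0 < z < 1.
  by rewrite subr_gt0 invf_lt1 ?p3 ?gtrBl ?invr_gt0 /=; lra.
have [z0 z1] := andP z01.
have lz : ln z < 0 by rewrite ln_lt0.
set Q2 := - (ln C / ln z).
have Q20 : 0 <= Q2.
  by rewrite oppr_ge0 mulr_ge0_le0 ?ln_ge0// invr_le0 ltW.
have zQ : z `^ Q2 = C^-1.
  rewrite /powR gt_eqF// /Q2 mulNr divfK ?lt_eqF// expRN lnK// posrE; lra.
exists (q + Q2); split=> [|u v c n a ha]; first by lra.
have [[n2 uv c0 nc1] _] := ha.
have n0 : 0 < n%:R :> R by rewrite ltr0n; nat_lia.
have t0 : 0 < n%:R * c by rewrite mulr_gt0.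
have tQ1 Q : 0 <= Q -> (n%:R * c) `^ Q <= 1.
  by move=> hQ; rewrite -[leRHS](powRr0 (n%:R * c)) ger_powR// t0 ltW.
have d0 : 0 <= g v - g u by rewrite subr_ge0; apply: g_homo; lra.
have nE1 : n%:R `^ (- eta) <= 2 `^ (- eta) :> R.
  rewrite !powRN lef_pV2 ?posrE ?powR_gt0//.
  apply: ge0_ler_powR; rewrite ?nnegrE ?(ltW eta0) ?ler0n//.
  by rewrite ler_nat.
have coarse k : k <= C^-1 -> k * ((n%:R * c) `^ q * (g v - g u)) <= image_sum g u v c n a.
  move=> hk; apply: (@le_trans _ _ (C^-1 * ((n%:R * c) `^ q * (g v - g u)))).
    by apply: ler_wpM2r => //; rewrite mulr_ge0 ?powR_ge0.
  by rewrite ler_pdivrMl; [exact: hcoarse|lra].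
have split_powers : n%:R `^ (- eta) * (n%:R * c) `^ (q + Q2) * (g v - g u) =
   n%:R `^ (- eta) * (n%:R * c) `^ Q2 * ((n%:R * c) `^ q * (g v - g u)).
  by rewrite powRD; [ring|rewrite (gt_eqF t0) implybT].
have [Mn|nM] := lerP M n%:R.
  rewrite split_powers; apply: coarse.
  apply: (@le_trans _ _ (n%:R `^ (- eta))).
    by rewrite ler_piMr ?powR_ge0// tQ1.
  rewrite powRN lef_pV2 ?posrE ?powR_gt0//; last by lra.
  have -> : C = M `^ eta.
    by rewrite /M -powRrM mulVf ?gt_eqF// powRr1//; lra.
  by apply: ge0_ler_powR; rewrite ?nnegrE ?(ltW eta0)// ltW.
have [fine|coarser] := lerP (3 ^+ m.+1 * (1 - n%:R * c)) 1.
  apply: le_trans (spaced_children_fine hg ha fine).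
  apply: ler_wpM2r => //.
  apply: (@le_trans _ _ (n%:R `^ (- eta))).
    by rewrite ler_piMr ?powR_ge0// tQ1//; lra.
  apply: (le_trans nE1).
  have : n.+1%:R * (H / (1 + H)) ^+ m.+1 <= (M + 1) * (H / (1 + H)) ^+ m.+1.
    by rewrite ler_pM2r ?exprn_gt0// -natr1; lra.
  lra.
rewrite split_powers; apply: coarse.
apply: (@le_trans _ _ ((n%:R * c) `^ Q2)).
  by rewrite ler_piMl ?powR_ge0//; lra.
rewrite -zQ; apply: ge0_ler_powR; rewrite ?nnegrE// ?(ltW t0) ?(ltW z0)//.
rewrite /z lerBrDl addrC -lerBrDl -[leLHS]mulr1 ler_pdivrMl; last by lra.
exact: ltW.
Qed.

End Children.

(** * Packings *)

Section Packing.
Context {R : realType}.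
Implicit Types (s d e : R) (F : set R).

(** Additivity and monotonicity of Lebesgue measure avoid sorting the intervals. *)
Lemma disjoint_itv_sum_length (I : choiceType) (X : seq I) (l h : I -> R) (a b : R) :
  uniq X -> a <= b ->
  (forall i, i \in X -> [/\ a <= l i, l i <= h i & h i <= b]) ->
  trivIset [set` X] (fun i => `[l i, h i]%classic) ->
  \sum_(i <- X) (h i - l i) <= b - a.
Proof.
move=> uX ab hX tX.
have mI i : measurable (`[l i, h i]%classic : set R) by exact: measurable_itv.
have lenE x y : x <= y -> lebesgue_measure (`[x, y]%classic : set R) = (y - x)%:E.
  rewrite lebesgue_measure_itv/= lte_fin le_eqVlt => /orP[/eqP ->|->]//.
  by rewrite ltxx subrr.
have : (lebesgue_measure (\bigcup_(i in [set` X]) `[l i, h i]%classic : set R)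
    <= lebesgue_measure (`[a, b]%classic : set R))%E.
  apply: le_measure; [apply/mem_set|apply/mem_set; exact: measurable_itv|].
    by apply: fin_bigcup_measurable => //; exact: finite_seq.
  move=> x [i /= /hX [al lh hb]]; rewrite !in_itv/= => /andP[lx xh].
  by rewrite (le_trans al lx) (le_trans xh hb).
rewrite measure_fin_bigcup; [|exact: finite_seq|exact: tX|by move=> i _; exact: mI].
rewrite lenE// -fsbig_seq//.
rewrite (eq_big_seq (fun i => (h i - l i)%:E)); last by move=> i /hX [_ ? _]; exact: lenE.
by rewrite sumEFin lee_fin.
Qed.

(** The balls are truncated to [[a, b]]; since their centres lie there, no truncation is empty and
    each length is the difference of the ends. *)
Lemma is_packing_sum_overlap d F (X : seq (R * R)) (a b : R) :
  uniq X -> a <= b -> is_packing d F [set` X] ->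
  \sum_(p <- X | a <= p.1 <= b) (Num.min (p.1 + p.2) b - Num.max (p.1 - p.2) a) <= b - a.
Proof.
move=> uX ab [hX tX]; rewrite -big_filter.
apply: disjoint_itv_sum_length; rewrite ?filter_uniq//.
  move=> p; rewrite mem_filter => /andP[/andP[ap pb] /hX [_ p0 _]].
  rewrite le_max lexx orbT ge_min lexx orbT; split=> //.
  by rewrite ge_max !le_min; apply/andP; split; apply/andP; split; lra.
move=> p q /=; rewrite !mem_filter => /andP[_ pX] /andP[_ qX] [x [/=]].
rewrite !in_itv/= !ge_max !le_min => /andP[/andP[h1 _] /andP[h2 _]] /andP[/andP[h3 _] /andP[h4 _]].
have [_ p0 _] := hX _ pX; have [_ q0 _] := hX _ qX.
apply: tX => //; exists x; split; rewrite closed_ball_itv//= in_itv/=.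
  by rewrite h1 h2.
by rewrite h3 h4.
Qed.

(** [\esum] is a supremum over finite subfamilies, and a subfamily of a packing is a packing. *)
Lemma packing_content_le s d F e :
  (forall X : seq (R * R), uniq X -> is_packing d F [set` X] ->
     \sum_(p <- X) (2 * p.2) `^ s <= e) ->
  (packing_content s d F <= e%:E)%E.
Proof.
move=> h; apply: ge_ereal_sup => _ [P [hP tP] <-].
apply: ge_ereal_sup => _ [A [finA AP] <-].
rewrite fsbig_finite//= sumEFin lee_fin; apply: h; first exact: finmap.fset_uniq.
have XA p : p \in finmap.enum_fset (fset_set A) -> A p.
  by move=> pA; apply/set_mem; rewrite -(in_fset_set finA); exact: pA.
split; first by move=> p /XA/AP/hP.
by move=> p q /XA/AP Pp /XA/AP Pq; exact: tP.
Qed.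

Lemma packing_content_ge (I : choiceType) (W : seq I) (z r : I -> R) s d F :
  uniq W ->
  (forall i, i \in W -> [/\ F (z i), 0 < r i & r i <= d]) ->
  (forall i j, i \in W -> j \in W -> i != j -> r i + r j < `|z i - z j|) ->
  ((\sum_(i <- W) (2 * r i) `^ s)%:E <= packing_content s d F)%E.
Proof.
move=> uW hW sepW.
(* A packing is a set of pairs, so two indices giving the same pair would be counted only once. *)
have inj : set_inj [set` W] (fun i => (z i, r i)).
  move=> i j /set_mem /= iW /set_mem /= jW [zz rr]; apply/eqP; apply/negP => /negP ij.
  have := sepW i j iW jW ij; rewrite zz subrr normr0.
  have [_ ? _] := hW i iW; have [_ ? _] := hW j jW; lra.
apply: ereal_sup_ubound.
exists ((fun i => (z i, r i)) @` [set` W]).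
  split; first by move=> _ [i /= iW <-]; exact: hW.
  move=> _ _ [i /= iW <-] [j /= jW <-] [x [/=]].
  have [_ ri _] := hW i iW; have [_ rj _] := hW j jW.
  rewrite !closed_ball_itv//= !in_itv/= => /andP[h1 h2] /andP[h3 h4].
  have [->//|ij] := eqVneq i j.
  exfalso; have := sepW i j iW jW ij.
  have : `|z i - z j| <= r i + r j by rewrite ler_norml; apply/andP; split; lra.
  lra.
rewrite /packing_sum esum_image//.
rewrite esum_fset; last 2 first.
- exact: finite_seq.
- by move=> i _; rewrite lee_fin powR_ge0.
by rewrite -fsbig_seq//= sumEFin.
Qed.

Lemma packing_content_ge0 s d F : (0 <= packing_content s d F)%E.
Proof.
apply: ereal_sup_ubound; exists set0.
  by split; [|move=> ? ? []].
by rewrite /packing_sum esum_set0.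
Qed.

Lemma packing_content_homo s F d1 d2 : d1 <= d2 ->
  (packing_content s d1 F <= packing_content s d2 F)%E.
Proof.
move=> d12; apply: ereal_sup_le => _ [P [hP tP] <-]; exists P => //.
by split=> // p /hP [? ? ?]; split=> //; exact: le_trans d12.
Qed.

(** The content is nondecreasing in [d], so its right limit at 0 is an infimum. *)
Lemma packing_premeasureE s F : packing_premeasure s F =
  ereal_inf [set packing_content s d F | d in `]0, +oo[%classic].
Proof.
apply: cvg_lim => //; apply: nondecreasing_at_right_cvge => //.
by move=> d1 d2 _ _ /packing_content_homo.
Qed.

Lemma packing_premeasure_ge0 s F : (0 <= packing_premeasure s F)%E.
Proof.
rewrite packing_premeasureE; apply: le_ereal_inf_tmp => _ [d _ <-].
exact: packing_content_ge0.
Qed.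

Lemma packing_premeasure_eq0 s F :
  (forall e, 0 < e -> exists2 d, 0 < d & (packing_content s d F <= e%:E)%E) ->
  packing_premeasure s F = 0%E.
Proof.
move=> h; apply/eqP; rewrite eq_le packing_premeasure_ge0 andbT.
apply/lee_addgt0Pr => e e0; rewrite add0e.
have [d d0 he] := h e e0; apply: le_trans he.
rewrite packing_premeasureE; apply: ereal_inf_lbound; exists d => //=.
by rewrite in_itv/= d0.
Qed.

Lemma packing_premeasure_eqy s F :
  (forall d e, 0 < d -> (e%:E <= packing_content s d F)%E) ->
  packing_premeasure s F = +oo%E.
Proof.
move=> h; rewrite packing_premeasureE; apply/eqP; rewrite -leye_eq.
apply: le_ereal_inf_tmp => y [d /=]; rewrite in_itv/= andbT => d0 <-.
by rewrite leye_eq; apply/eqP/eqyP => e e0; exact: h.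
Qed.

Lemma packing_measure_eq0 s F : packing_premeasure s F = 0%E ->
  packing_measure s F = 0%E.
Proof.
move=> h; apply/eqP; rewrite eq_le; apply/andP; split.
  apply: ereal_inf_lbound; exists (fun i : nat => if i == 0%N then F else set0).
    by move=> x Fx; exists 0%N.
  rewrite eseries0// => -[|i] _ _; first exact: h.
  apply: packing_premeasure_eq0 => e e0; exists 1 => //.
  apply: packing_content_le => -[|p X] _ [hX _]; first by rewrite big_nil ltW.
  by have [] := hX p; rewrite //= mem_head.
apply: le_ereal_inf_tmp => _ [G _ <-].
by apply: nneseries_ge0 => i _ _; exact: packing_premeasure_ge0.
Qed.

Lemma packing_measure_eqy s F :
  (forall G : (set R)^nat, F `<=` \bigcup_i G i ->
     exists i, packing_premeasure s (G i) = +oo%E) ->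
  packing_measure s F = +oo%E.
Proof.
move=> h; apply/eqP; rewrite -leye_eq; apply: le_ereal_inf_tmp => _ [G FG <-].
have [i hi] := h G FG.
by rewrite (nneseries_pinfty _ _ hi)// => j _; exact: packing_premeasure_ge0.
Qed.

Lemma packing_dim_le s F : 0 <= s -> packing_premeasure s F = 0%E ->
  (packing_dim F <= s%:E)%E.
Proof.
move=> s0 h; apply: ereal_inf_lbound; exists s => //.
by split=> //; exact: packing_measure_eq0.
Qed.

Lemma packing_dim_ge s F : (forall t, 0 <= t -> t < s -> packing_measure t F <> 0%E) ->
  (s%:E <= packing_dim F)%E.
Proof.
move=> h; apply: le_ereal_inf_tmp => _ [t [t0 ht] <-].
by rewrite lee_fin leNgt; apply/negP => /h - /(_ t0).
Qed.

(** For the exponent [1 + e] one factor [2 r] of each term sums to at most a length, and the other,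
    [(2 r) ^ e], is small uniformly in the packing. *)
Lemma packing_dim_bounded_le1 F a b : a <= b -> F `<=` `[a, b]%classic ->
  (packing_dim F <= 1%:E)%E.
Proof.
move=> ab Fab; apply/lee_addgt0Pr => e e0; rewrite -EFinD.
apply: packing_dim_le; first lra.
apply: packing_premeasure_eq0 => eps eps0.
(* Balls of radius at most 1 centred in [[a, b]] stay in [[a - 1, b + 1]], of length [b - a + 2]. *)
set K := 2 * (b - a + 2).
have K0 : 0 < K by rewrite /K; lra.
set d := Num.min 1 ((eps / K) `^ e^-1 / 2).
have d0 : 0 < d by rewrite lt_min ltr01 /= divr_gt0// powR_gt0// divr_gt0.
have d1 : d <= 1 by rewrite ge_min lexx.
have d2 : (2 * d) `^ e <= eps / K.
  have h : (eps / K) = ((eps / K) `^ e^-1) `^ e.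
    by rewrite -powRrM mulVf ?gt_eqF// powRr1// divr_ge0// ltW.
  rewrite [leRHS]h; apply: ge0_ler_powR; rewrite ?nnegrE ?powR_ge0 ?(ltW e0)//; first lra.
  have : d <= (eps / K) `^ e^-1 / 2 by rewrite ge_min lexx orbT.
  lra.
exists d => //; apply: packing_content_le => X uX pX.
have [hX tX] := pX.
have ov : \sum_(p <- X) (2 * p.2) <= b - a + 2.
  have := @is_packing_sum_overlap d F X (a - 1) (b + 1) uX ltac:(lra) pX.
  rewrite (_ : b + 1 - (a - 1) = b - a + 2); last by ring.
  apply: le_trans; rewrite le_eqVlt; apply/orP; left; apply/eqP.
  rewrite [RHS]big_mkcond; apply: eq_big_seq => p pX'.
  have [/Fab /=] := hX p pX'; rewrite in_itv/= => /andP[h1 h2] h3 h4.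
  rewrite ifT; last by apply/andP; split; lra.
  by rewrite min_l ?max_l; [ring|lra|lra].
have -> : eps = eps / K * K by rewrite divfK// gt_eqF.
apply: (@le_trans _ _ (\sum_(p <- X) eps / K * (2 * p.2))).
  rewrite !big_seq; apply: ler_sum => p /hX [_ p0 pd].
  have p2 : 0 < 2 * p.2 by lra.
  rewrite powRD; last by rewrite (gt_eqF p2) implybT.
  rewrite powRr1 ?(ltW p2)// [leLHS]mulrC; apply: ler_wpM2r; first exact: ltW.
  apply: le_trans d2; apply: ge0_ler_powR; rewrite ?nnegrE ?(ltW e0)//; lra.
rewrite -mulr_sumr; apply: ler_wpM2l; first by rewrite divr_ge0// ltW.
by apply: (le_trans ov); rewrite /K; lra.
Qed.

End Packing.

(** * Homogeneous Moran sets with uniform outer gaps *)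

Lemma prefix_of_rcons (U : eqType) (s t : seq U) i :
  prefix s (rcons t i) = (s == rcons t i) || prefix s t.
Proof.
apply/idP/orP => [/prefixP[v]|[/eqP->|/prefix_trans]]; last 2 first.
- exact: prefix_refl.
- by apply; exact: prefix_rcons.
case: (lastP v) => [|{}v x]; first by rewrite cats0 => ->; left.
by rewrite -rcons_cat => /rcons_inj[-> _]; right; exact: prefix_prefix.
Qed.

(** * Words and enumeration of their extensions *)

Section Words.
Variable n : nat -> nat.

Lemma words_rcons k s i : words n k s -> (1 <= i <= n k.+1)%N -> words n k.+1 (rcons s i).
Proof.
move=> [sk hs] hi; split; first by rewrite size_rcons sk.
move=> j; rewrite ltnS leq_eqVlt nth_rcons sk => /orP[/eqP->|jk].
  by rewrite ltnn eqxx.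
by rewrite jk; exact: hs.
Qed.

Lemma words_rconsE k s i : words n k.+1 (rcons s i) -> words n k s /\ (1 <= i <= n k.+1)%N.
Proof.
move=> [/eqP]; rewrite size_rcons eqSS => /eqP sk hs; split.
  by split=> // j jk; have := hs j (ltnW jk); rewrite nth_rcons sk jk.
by have := hs k (ltnSn k); rewrite nth_rcons sk ltnn eqxx.
Qed.

(** The extensions of [t] by [m] letters, as a list so that they can be summed over; the arity is
    read off the size of the word. *)
Fixpoint descendants (t : seq nat) (m : nat) : seq (seq nat) :=
  if m is m'.+1 then
    [seq rcons s i | s <- descendants t m', i <- iota 1 (n (size s).+1)]
  else [:: t].

Lemma descendants_words k t m s : words n k t -> s \in descendants t m ->
  words n (k + m) s /\ prefix t s.
Proof.
move=> ht; elim: m s => [|m IH] s /=.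
  by rewrite inE => /eqP ->; rewrite addn0; split=> //; exact: prefix_refl.
move=> /allpairsPdep[s' [i [/IH [hs' pre] hi ->]]]; rewrite addnS; split.
  apply: words_rcons => //; move: hi; case: (hs') => -> _.
  by rewrite mem_iota add1n ltnS.
by apply: prefix_trans pre _; exact: prefix_rcons.
Qed.

Lemma descendants_uniq t m : uniq (descendants t m).
Proof.
elim: m => [//|m IH] /=; apply: allpairs_uniq_dep => //.
  by move=> s _; exact: iota_uniq.
by move=> [s i] [s' i'] _ _ /= /rcons_inj [-> ->].
Qed.

Lemma words_descendants k s : words n k s -> s \in descendants [::] k.
Proof.
elim: k s => [|k IH] s; first by move=> [/size0nil-> _]; rewrite inE.
case: (lastP s) => [[]//|{}s i] /words_rconsE [hs hi].
apply/allpairsPdep; exists s, i; split=> //; first exact: IH.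
by rewrite mem_iota; case: hs => -> _; rewrite add1n ltnS.
Qed.

Lemma big_descendantsS (R : realType) (F : seq nat -> R) k t m : words n k t ->
  \sum_(s <- descendants t m.+1) F s =
  \sum_(s <- descendants t m) \sum_(1 <= i < (n (k + m).+1).+1) F (rcons s i).
Proof.
move=> ht; rewrite big_allpairs_dep; apply: eq_big_seq => s hs.
have [[-> _] _] := descendants_words ht hs.
by rewrite /index_iota subn1.
Qed.

Lemma sum_descendants_cst (R : realType) (x : R) m :
  \sum_(s <- descendants [::] m) x = (\prod_(1 <= j < m.+1) (n j)%:R) * x.
Proof.
elim: m => [|m IH]; first by rewrite /= big_seq1 big_geq// mul1r.
rewrite (@big_descendantsS _ _ 0%N) //.
rewrite add0n [X in _ = X * _]big_nat_recr//= mulrAC -IH mulr_suml; apply: eq_bigr => s _.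
by rewrite sumr_const_nat subn1 mulr_natr.
Qed.

End Words.

(* [sp k] and [w * sp k] bound the distance between the left endpoints of consecutive
   siblings of level [k + 1], which is what (A) and (B) have in common. *)
Record moran_tree {R : realType} (n : nat -> nat) (c : nat -> R) (lo hi : seq nat -> R)
    (L Rr sp : nat -> R) (w : R) : Prop := MoranTree {
  mt_n : forall k, (2 <= n k.+1)%N;
  mt_c : forall k, 0 < c k.+1;
  mt_nc : forall k, (n k.+1)%:R * c k.+1 < 1;
  mt_root : lo [::] = 0;
  mt_len : forall k s, words n k s -> hi s = lo s + delta c k;
  mt_L : forall k, 0 <= L k.+1;
  mt_R : forall k, 0 <= Rr k.+1;
  mt_first : forall k s, words n k s -> lo (rcons s 1%N) = lo s + L k.+1;
  mt_last : forall k s, words n k s -> hi (rcons s (n k.+1)) = hi s - Rr k.+1;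
  mt_w : 1 <= w;
  mt_sp : forall k, delta c k.+1 <= sp k;
  mt_step : forall k s i, words n k s -> (1 <= i < n k.+1)%N ->
    sp k <= lo (rcons s i.+1) - lo (rcons s i) <= w * sp k }.

Section MoranTree.
Context {R : realType} (n : nat -> nat) (c : nat -> R) (lo hi : seq nat -> R).
Context (L Rr sp : nat -> R) (w : R).
Hypothesis T : moran_tree n c lo hi L Rr sp w.

(* For [s] of length [k], [hull k] is the length of the convex hull of the
   children of [I_s]. *)
Definition hull_length k : R := delta c k - L k.+1 - Rr k.+1.
Local Notation hull := hull_length.
(** The scale [rho_k]; [word_count] below is [N_k]. *)
Definition mesh_size k : R := hull k / (n k.+1)%:R.
Local Notation mesh := mesh_size.
Definition word_count k : R := \prod_(1 <= j < k.+1) (n j)%:R.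
Local Notation nwords := word_count.

Lemma deltaS k : delta c k.+1 = delta c k * c k.+1.
Proof. by rewrite /delta big_nat_recr. Qed.

Lemma delta_gt0 k : 0 < delta c k.
Proof.
elim: k => [|k IH]; first by rewrite /delta big_geq.
by rewrite deltaS mulr_gt0// (mt_c T).
Qed.

Lemma c_lt_half k : c k.+1 < 2^-1.
Proof.
have nc := mt_nc T k; have c0 := mt_c T k.
have : 2 <= (n k.+1)%:R :> R by rewrite (ler_nat _ 2) (mt_n T).
nra.
Qed.

Lemma delta_le k : delta c k <= 2^-1 ^+ k.
Proof.
elim: k => [|k IH]; first by rewrite /delta big_geq.
rewrite deltaS exprSr; have := c_lt_half k; have := mt_c T k; have := delta_gt0 k.
by move=> d0 c0 ch; apply: ler_pM => //; lra.
Qed.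

(** A witness at every level, which turns the statements about words into inequalities between
    numbers depending on the level only. *)
Lemma ones_words k : words n k (nseq k 1%N).
Proof.
split; first by rewrite size_nseq.
by case=> [|j] jk; rewrite nth_nseq jk /=; have := mt_n T; move=> h; apply/ltnW/h.
Qed.

Lemma n_gt0 k : 0 < (n k.+1)%:R :> R.
Proof. by rewrite ltr0n; apply: ltnW; exact: mt_n T k. Qed.

Lemma lo_last k s : words n k s -> lo (rcons s (n k.+1)) + delta c k.+1 = hi s - Rr k.+1.
Proof.
move=> hs; rewrite -(mt_last T hs); symmetry; apply: (mt_len T).
by apply: words_rcons => //; rewrite leqnn andbT ltnW// (mt_n T).
Qed.

Lemma sum_sp k s : words n k s ->
  (n k.+1)%:R * sp k - sp k <= hull k - delta c k.+1.
Proof.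
move=> hs; have n2 := mt_n T k.
have : \sum_(1 <= i < n k.+1) sp k <=
    \sum_(1 <= i < n k.+1) (lo (rcons s i.+1) - lo (rcons s i)).
  by rewrite !big_nat; apply: ler_sum => i hi'; have /andP[] := mt_step T hs hi'.
rewrite (telescope_sumr (fun i => lo (rcons s i)) (ltnW n2)) sumr_const_nat.
rewrite -[_ *+ _]mulr_natl natrB ?(ltnW n2)// (mt_first T hs).
have := lo_last hs; rewrite (mt_len T hs) /hull_length; lra.
Qed.

Lemma sp_gt0 k : 0 < sp k.
Proof. exact: lt_le_trans (delta_gt0 k.+1) (mt_sp T k). Qed.

Lemma hull_le k : hull k <= delta c k.
Proof. by rewrite /hull_length; have := mt_L T k; have := mt_R T k; lra. Qed.

Lemma hull_ge k : (n k.+1)%:R * delta c k.+1 <= hull k.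
Proof.
have := sum_sp (ones_words k); have := mt_sp T k.
have n2 : 1 <= (n k.+1)%:R :> R by rewrite ler1n ltnW// (mt_n T).
nra.
Qed.

Lemma hull_gt0 k : 0 < hull k.
Proof. by apply: lt_le_trans (hull_ge k); rewrite mulr_gt0 ?n_gt0 ?delta_gt0. Qed.

Lemma mesh_gt0 k : 0 < mesh k.
Proof. by rewrite divr_gt0 ?hull_gt0 ?n_gt0. Qed.

Lemma mesh_hull k : (n k.+1)%:R * mesh k = hull k.
Proof. by rewrite /mesh_size mulrC divfK// gt_eqF// n_gt0. Qed.

Lemma mesh_ge k : delta c k.+1 <= mesh k.
Proof. by rewrite -(ler_pM2l (n_gt0 k)) mesh_hull hull_ge. Qed.

Lemma mesh_le_delta k : mesh k <= delta c k / 2.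
Proof.
rewrite /mesh_size ler_pdivrMr ?n_gt0//; have := hull_le k; have := delta_gt0 k.
have : 2 <= (n k.+1)%:R :> R by rewrite (ler_nat _ 2) (mt_n T).
nra.
Qed.

Lemma mesh_le k : mesh k <= 2^-1 ^+ k.
Proof. by have := mesh_le_delta k; have := delta_le k; have := delta_gt0 k; lra. Qed.

Lemma mesh_le1 k : mesh k <= 1.
Proof.
by apply: le_trans (mesh_le k) _; rewrite exprn_ile1//; lra.
Qed.

Lemma meshS_le k : mesh k.+1 <= mesh k.
Proof. by have := mesh_le_delta k.+1; have := mesh_ge k; have := delta_gt0 k.+1; lra. Qed.

(** [n - 1] steps fit in the hull, and [n / (n - 1) <= 2]. *)
Lemma sp_le_mesh k : sp k <= 2 * mesh k.
Proof.
have := sum_sp (ones_words k); rewrite -mesh_hull => h.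
have := delta_gt0 k.+1; have := sp_gt0 k; have := mesh_gt0 k.
have : 2 <= (n k.+1)%:R :> R by rewrite (ler_nat _ 2) (mt_n T).
nra.
Qed.

Lemma nwordsS k : nwords k.+1 = nwords k * (n k.+1)%:R.
Proof. by rewrite /word_count big_nat_recr. Qed.

Lemma nwords_gt0 k : 0 < nwords k.
Proof.
elim: k => [|k IH]; first by rewrite /word_count big_geq.
by rewrite nwordsS mulr_gt0 ?n_gt0.
Qed.

Lemma moran_spaced k s : words n k s ->
  spaced_children w (lo s) (hi s) (c k.+1) (n k.+1) (fun i => lo (rcons s i)).
Proof.
move=> hs; have dE : c k.+1 * (hi s - lo s) = delta c k.+1.
  by rewrite (mt_len T hs) deltaS; ring.
have w1 := mt_w T.
split; split; rewrite ?dE.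
- exact: mt_n T k.
- by rewrite (mt_len T hs) ltrDl delta_gt0.
- exact: mt_c T k.
- exact: mt_nc T k.
- by rewrite (mt_first T hs) lerDl (mt_L T).
- by rewrite (lo_last hs); have := mt_R T k; lra.
move=> i hi'; have /andP[h1 h2] := mt_step T hs hi'; split.
  by have := mt_sp T k; lra.
have n0 := n_gt0 k; have h3 := sp_le_mesh k; have h4 := mesh_hull k; have h5 := hull_le k.
rewrite (mt_len T hs).
apply: (@le_trans _ _ (w * (2 * mesh k) * (n k.+1)%:R)).
  by apply: ler_wpM2r; [exact: ltW|nra].
nra.
Qed.

Lemma lo_child_lt k s i j : words n k s -> (1 <= i < j)%N -> (j <= n k.+1)%N ->
  lo (rcons s i) + sp k <= lo (rcons s j).
Proof.
move=> hs /andP[i1]; elim: j => [//|j IH]; rewrite ltnS leq_eqVlt => /orP[/eqP<-|ij] jn.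
  by have := mt_step T hs (i := i); rewrite i1 jn => /(_ isT); lra.
have := IH ij (ltnW jn); have := sp_gt0 k.
by have := mt_step T hs (i := j); rewrite (leq_trans i1 (ltnW ij)) jn => /(_ isT); lra.
Qed.

Lemma child_hull k s i : words n k s -> (1 <= i <= n k.+1)%N ->
  lo s + L k.+1 <= lo (rcons s i) /\ hi (rcons s i) <= lo s + L k.+1 + hull k.
Proof.
move=> hs hi'; have [i1 i2] := andP hi'; have sp0 := sp_gt0 k; split.
  rewrite -(mt_first T hs); move: i1; rewrite leq_eqVlt => /orP[/eqP<-//|i1].
  have := @lo_child_lt k s 1%N i hs; rewrite i1 i2 => /(_ isT isT); lra.
have h : lo (rcons s i) <= lo (rcons s (n k.+1)).
  move: i2; rewrite leq_eqVlt => /orP[/eqP<-//|i2].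
  have := @lo_child_lt k s i (n k.+1) hs; rewrite i1 i2 leqnn => /(_ isT isT); lra.
have := lo_last hs; rewrite (mt_len T (words_rcons hs hi')) (mt_len T hs) /hull_length; lra.
Qed.

Lemma hull_mem k x : moran_set n lo hi x -> exists2 s, s \in descendants n [::] k &
  lo s + L k.+1 <= x <= lo s + L k.+1 + hull k.
Proof.
(* Level [k + 1] rather than [k]: a point in a child of [I_s] lies in the hull of the children. *)
move=> /(_ k.+1 I) [s' /= hs'].
case: (lastP s') hs' => [[]//|s i hsi]; rewrite in_itv/= => /andP[h1 h2].
have [hs hi'] := words_rconsE hsi; have [h3 h4] := child_hull hs hi'.
exists s; first exact: words_descendants.
by apply/andP; split; lra.
Qed.

Lemma prefix_nested k k' s s' : words n k s -> words n k' s' -> prefix s s' ->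
  lo s <= lo s' /\ hi s' <= hi s.
Proof.
move=> hs; elim: k' s' => [|k' IH] s'.
  by move=> [/size0nil-> _]; rewrite prefixs0 => /eqP ->.
case: (lastP s') => [[]//|{}s' i] hsi; rewrite prefix_of_rcons => /orP[/eqP ->//|/IH h].
have [hs' hi'] := words_rconsE hsi; have [h1 h2] := h hs'; have [h3 h4] := child_hull hs' hi'.
have := mt_L T k'; have := mt_R T k'; have := mt_len T hs'.
by move: h4; rewrite /hull_length; split; lra.
Qed.

Lemma words_disjoint k s s' : words n k s -> words n k s' -> s != s' ->
  hi s <= lo s' \/ hi s' <= lo s.
Proof.
elim: k s s' => [|k IH] s s'; first by move=> [/size0nil-> _] [/size0nil-> _]; rewrite eqxx.
case: (lastP s) => [[]//|{}s i] hsi; case: (lastP s') => [[]//|{}s' i'] hsi'.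
have [hs hi'] := words_rconsE hsi; have [hs' hi''] := words_rconsE hsi'.
rewrite (mt_len T hsi) (mt_len T hsi').
have [<-{s' hs' hsi'}|ss _] := eqVneq s s'; last first.
  have [h1 _] := child_hull hs hi'; have [_ h2] := child_hull hs hi'.
  have [h3 _] := child_hull hs' hi''; have [_ h4] := child_hull hs' hi''.
  have := mt_L T k; have := mt_R T k; move: h2 h4.
  rewrite (mt_len T hsi) (mt_len T hsi') /hull_length.
  by case: (IH _ _ hs hs' ss); rewrite ?(mt_len T hs) ?(mt_len T hs') => *; [left|right]; lra.
have [a1 a2] := andP hi'; have [b1 b2] := andP hi''; have := mt_sp T k => spd.
have [ii|ii|->] := ltngtP i i'; last by rewrite eqxx.
  by left; have := @lo_child_lt k s i i' hs; rewrite a1 ii b2 => /(_ isT isT); lra.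
by right; have := @lo_child_lt k s i' i hs; rewrite b1 ii a2 => /(_ isT isT); lra.
Qed.

End MoranTree.

(** The spacing unit is the child length plus the smallest inner gap. The largest gap is at most
    [w1] times the first summand under (A) and [w2] times the second under (B), so one constant
    serves both cases. *)
Lemma moran_structure_tree {R : realType} (n : nat -> nat) (c : nat -> R)
    (lo hi : seq nat -> R) (L Rr : nat -> R) (w1 w2 : R) :
  (forall k, (1 <= k)%N -> (2 <= n k)%N) ->
  (forall k, (1 <= k)%N -> 0 < c k) ->
  (forall k, (1 <= k)%N -> (n k)%:R * c k < 1) ->
  moran_structure n c lo hi ->
  (forall k, (1 <= k)%N -> 0 <= L k) -> (forall k, (1 <= k)%N -> 0 <= Rr k) ->
  (forall k s, words n k s -> gap n lo hi s 0 = L k.+1) ->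
  (forall k s, words n k s -> gap n lo hi s (n k.+1) = Rr k.+1) ->
  0 < w1 -> 0 < w2 ->
  (forall k, (1 <= k)%N ->
       nu_max n lo hi k <= w1 * delta c k \/
       nu_max n lo hi k <= w2 * nu_min n lo hi k) ->
  moran_tree n c lo hi L Rr (fun k => delta c k.+1 + nu_min n lo hi k.+1) (1 + w1 + w2).
Proof.
move=> hn hc hnc [[lo0 hi1] nest ord ratio] hL0 hR0 hL hR w10 w20 hAB.
have len k s : words n k s -> hi s = lo s + delta c k.
  elim: k s => [|k IH] s.
    by move=> [/size0nil -> _]; rewrite lo0 hi1 /delta big_geq// add0r.
  case: (lastP s) => [[]//|{}s i] /words_rconsE [hs hi'].
  have := ratio k.+1 s i isT hs hi'; rewrite (IH s hs) addrAC subrr add0r.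
  have := hc k.+1 isT => c0 h.
  (* If the length vanished, the convention [x / 0 = 0] would make the ratio [c k.+1] zero. *)
  have d0 : delta c k != 0.
    by apply/eqP => d0; move: h; rewrite d0 invr0 mulr0 => h; rewrite -h ltxx in c0.
  rewrite /delta big_nat_recr//= -/(delta c k) -h mulrC divfK//; lra.
have delta0 k : 0 < delta c k.
  rewrite /delta; elim: k => [|k IH]; first by rewrite big_geq.
  by rewrite big_nat_recr//= mulr_gt0// hc.
have gap_mid k s i : words n k s -> (1 <= i < n k.+1)%N ->
    gap n lo hi s i = lo (rcons s i.+1) - hi (rcons s i).
  move=> [sk _] /andP[i1 i2]; rewrite /gap sk; case: i i1 i2 => // i _ i2.
  by rewrite /= ltn_eqF.
have gap_in k s i : words n k s -> (1 <= i < n k.+1)%N ->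
    inner_gaps n lo hi k.+1 (gap n lo hi s i).
  move=> hs hi'; exists (s, i) => //; split=> //=.
  by have := hn k.+1 isT; lia.
have mid k s i : words n k s -> (1 <= i <= (n k.+1).-1)%N ->
    [/\ words n k.+1 (rcons s i), words n k.+1 (rcons s i.+1), (1 <= i < n k.+1)%N
      & 0 <= gap n lo hi s i].
  move=> hs hi'; have hi2 : (1 <= i < n k.+1)%N by have := hn k.+1 isT; lia.
  split=> //; [by apply: words_rcons => //; lia|by apply: words_rcons => //; lia|].
  by rewrite (gap_mid k)//; have := ord k.+1 s i isT hs hi'; lra.
(* Boundedness is what makes [sup] and [inf] of the gaps actual bounds. *)
have gap_bounds k x : inner_gaps n lo hi k.+1 x -> 0 <= x <= 1.
  move=> [[s i] /= [hs hi'] <-]; have [h1 h2 h3 g0] := mid k s i hs hi'.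
  rewrite g0 (gap_mid k)//=.
  have inside j t : words n j t -> 0 <= lo t /\ hi t <= 1.
    elim: j t => [|j IH] t; first by move=> [/size0nil-> _]; rewrite lo0 hi1.
    case: (lastP t) => [[]//|{}t l] /words_rconsE[ht hl].
    by have [? ?] := IH t ht; have [? _ ?] := nest j.+1 t l isT ht hl; split; lra.
  have [a1 _] := inside _ _ h1; have [_ b2] := inside _ _ h2.
  by rewrite (len _ _ h1); rewrite (len _ _ h2) in b2; have := delta0 k.+1; lra.
have gap_ub k x : inner_gaps n lo hi k.+1 x -> x <= nu_max n lo hi k.+1.
  move=> hx; apply: ub_le_sup => //; exists 1 => y /gap_bounds /andP[]//.
have gap_lb k x : inner_gaps n lo hi k.+1 x -> nu_min n lo hi k.+1 <= x.
  move=> hx; apply: ge_inf => //; exists 0 => y /gap_bounds /andP[]//.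
have ones k : words n k (nseq k 1%N).
  split; first by rewrite size_nseq.
  by move=> j jk; rewrite nth_nseq jk /=; apply/ltnW/hn.
have nu0 k : 0 <= nu_min n lo hi k.+1.
  apply: lb_le_inf; last by move=> y /gap_bounds /andP[].
  by exists (gap n lo hi (nseq k 1%N) 1); apply: (gap_in k) => //; have := hn k.+1 isT; lia.
split=> //.
- by move=> k; exact: hn.
- by move=> k; exact: hc.
- by move=> k; exact: hnc.
- by move=> k; exact: hL0.
- by move=> k; exact: hR0.
- by move=> k s /hL; rewrite /gap eqxx; lra.
- move=> k s hs; have := hR k s hs; have := hn k.+1 isT; case: hs => sk _.
  by rewrite /gap sk; case: (n k.+1) => // m _; rewrite eqxx /=; lra.
- by lra.
- by move=> k; rewrite lerDl.
move=> k s i hs hi'; have g1 := gap_ub k _ (gap_in k s i hs hi').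
have g2 := gap_lb k _ (gap_in k s i hs hi').
have d0 := delta0 k.+1; have v0 := nu0 k.
rewrite (gap_mid k)// in g1 g2.
rewrite (len k.+1) in g1 g2; last by apply: words_rcons => //; lia.
apply/andP; split; first lra.
have : lo (rcons s i.+1) - lo (rcons s i) <= delta c k.+1 + nu_max n lo hi k.+1 by lra.
move/le_trans; apply.
have [h|h] := hAB k.+1 isT; nra.
Qed.

(** * Scales forced by a full packing dimension *)

Lemma ler_big_term {R : realType} (I : eqType) (r : seq I) (F : I -> R) (i : I) :
  i \in r -> (forall j, 0 <= F j) -> F i <= \sum_(j <- r) F j.
Proof.
by move=> ir F0; rewrite (big_rem i ir)/= lerDl; apply: sumr_ge0.
Qed.

Lemma geometric_tail_le {R : realType} (z : R) K K' : 0 < z -> z < 1 -> (K <= K')%N ->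
  \sum_(K <= k < K') z ^+ k <= z ^+ K / (1 - z).
Proof.
move=> z0 z1 KK'; rewrite ler_pdivlMr; last by lra.
rewrite mulr_suml (eq_bigr (fun k => (- z ^+ k.+1) - (- z ^+ k))); last first.
  by move=> k _; rewrite exprSr; ring.
rewrite (telescope_sumr (fun k => - z ^+ k) KK').
by have := exprn_ge0 K' (ltW z0); lra.
Qed.

Lemma expr_small {R : realType} (z e : R) : 0 < z -> z < 1 -> 0 < e ->
  exists m, z ^+ m <= e.
Proof.
move=> z0 z1 e0; have [e1|e1] := lerP 1 e; first by exists 0%N.
have [||m /andP[_]] := @expr_bracket R z^-1 e^-1.
- by rewrite invf_gt1.
- by rewrite invf_ge1// ltW.
by rewrite exprVn ltf_pV2 ?posrE ?exprn_gt0// => /ltW; exists m.+1.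
Qed.

Section LargeScales.
Context {R : realType} (n : nat -> nat) (c : nat -> R) (lo hi : seq nat -> R).
Context (L Rr sp : nat -> R) (w : R).
Hypothesis T : moran_tree n c lo hi L Rr sp w.
Local Notation mesh := (mesh_size n c L Rr).
Local Notation hull := (hull_length c L Rr).
Local Notation nwords := (@word_count R n).
Local Notation E := (moran_set n lo hi).

Lemma mesh_homo i j : (i <= j)%N -> mesh j <= mesh i.
Proof.
elim: j => [|j IH]; first by rewrite leqn0 => /eqP ->.
rewrite leq_eqVlt => /orP[/eqP->//|ij].
exact: le_trans (meshS_le T j) (IH ij).
Qed.

Lemma mesh_small (e : R) : 0 < e -> exists K, forall k, (K <= k)%N -> mesh k <= e.
Proof.
move=> e0; have [||m hm] := @expr_small R 2^-1 e _ _ e0; [lra|lra|].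
exists m => k /mesh_homo mk; apply: (le_trans mk); apply: le_trans hm.
exact: mesh_le T m.
Qed.

Lemma mesh_below (X : seq (R * R)) : (forall p, p \in X -> 0 < p.2) ->
  exists K, forall p, p \in X -> mesh K < p.2.
Proof.
elim: X => [|q X IH] hX; first by exists 0%N.
have [|K hK] := IH; first by move=> p pX; apply: hX; rewrite inE pX orbT.
have q0 := hX q (mem_head _ _).
have [|K' hK'] := @mesh_small (q.2 / 2); first by lra.
exists (maxn K K') => p; rewrite inE => /orP[/eqP->|/hK].
  by have := hK' (maxn K K') (leq_maxr _ _); lra.
exact/le_lt_trans/mesh_homo/leq_maxl.
Qed.

Lemma mesh_between K K' (r : R) : mesh K' < r -> r <= mesh K ->
  exists k, [/\ (K <= k < K')%N, mesh k.+1 < r & r <= mesh k].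
Proof.
move=> rK' rK; have ex : exists j, mesh j < r by exists K'.
have := ex_minnP ex; case=> j jr jmin.
have Kj : (K < j)%N.
  by rewrite ltnNge; apply/negP => /mesh_homo h; lra.
case: j jr jmin Kj => [//|k] jr jmin Kk; exists k; split=> //.
  by rewrite -ltnS Kk jmin.
by rewrite leNgt; apply/negP => /jmin; rewrite ltnn.
Qed.

(** If [r >= H] the ball covers the whole interval, and [r ^ s <= M ^ s]. If [r < H] the overlap is
    at least [r], and [r ^ (s - 1) <= M' ^ (s - 1)] because [s < 1]. *)
Lemma ball_overlap_lower (a H x r s M M' : R) : 0 < H -> a <= x <= a + H ->
  0 < s -> s < 1 -> 0 < M' -> M' < r -> r <= M ->
  r `^ s <= (M `^ s / H + M' `^ (s - 1)) *
    (Num.min (x + r) (a + H) - Num.max (x - r) a).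
Proof.
move=> H0 /andP[ax xb] s0 s1 M'0 M'r rM; rewrite mulrDl.
have r0 : 0 < r by lra.
have p1 : 0 <= M `^ s / H by rewrite divr_ge0 ?powR_ge0// ltW.
have p2 : 0 <= M' `^ (s - 1) by exact: powR_ge0.
set o := _ - _.
have o0 : 0 <= o.
  by rewrite subr_ge0 ge_max !le_min; apply/andP; split; apply/andP; split; lra.
have [Hr|rH] := lerP H r.
  have -> : o = H by rewrite /o min_r ?max_r; [ring|lra|lra].
  rewrite divfK ?gt_eqF//; apply: (@le_trans _ _ (M `^ s)).
    by apply: ge0_ler_powR; rewrite ?nnegrE; lra.
  by rewrite lerDl mulr_ge0// ltW.
have ro : r <= o.
  rewrite /o lerBrDr le_min -!lerBrDl !ge_max -!andbA; apply/and4P; split; lra.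
apply: (@le_trans _ _ (M' `^ (s - 1) * o)); last by rewrite lerDr mulr_ge0.
rewrite -(mulr_powRB1 (ltW r0) s0) mulrC; apply: ler_pM => //.
- exact: powR_ge0.
- exact: ltW.
rewrite -[s - 1]opprB !powRN lef_pV2 ?posrE ?powR_gt0//.
by apply: ge0_ler_powR; rewrite ?nnegrE; lra.
Qed.

(** By contraposition: if the inequality fails from [K] on, the premeasure of exponent [1 - e / 2]
    vanishes, so the dimension is below 1. *)
Lemma packing_dim1_nwords_hull (e : R) : packing_dim E = 1%E -> 0 < e -> e < 1 ->
  forall K, exists2 k, (K <= k)%N & mesh k `^ e <= nwords k * hull k.
Proof.
move=> dimE e0 e1 K; apply: contrapT => hcontra.
have hP k : (K <= k)%N -> nwords k * hull k < mesh k `^ e.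
  move=> Kk; rewrite ltNge; apply/negP => h; apply: hcontra; by exists k.
pose s := 1 - e / 2.
suff prem0 : packing_premeasure s E = 0%E.
  have := @packing_dim_le _ s E _ prem0; rewrite dimE lee_fin /s => h.
  have := h ltac:(lra); lra.
apply: packing_premeasure_eq0 => eps eps0.
pose z : R := 2^-1 `^ (e / 2).
have z0 : 0 < z by rewrite powR_gt0//; lra.
have z1 : z < 1.
  rewrite /z /powR gt_eqF; last by lra.
  rewrite -[ltRHS]expR0 ltr_expR pmulr_rlt0; last by lra.
  by rewrite ln_lt0//; apply/andP; split; lra.
have mesh_pow k : mesh k `^ (e / 2) <= z ^+ k.
  have -> : z ^+ k = (2^-1 ^+ k) `^ (e / 2).
    rewrite -powR_mulrn ?powR_ge0// -powR_mulrn; last by lra.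
    by rewrite /z -!powRrM mulrC.
  apply: ge0_ler_powR; rewrite ?nnegrE ?exprn_ge0 ?(ltW (mesh_gt0 T k)) ?(mesh_le T k)//; lra.
(* The levels from [K1] on will contribute at most [4 * z ^ K1 / (1 - z)] in total. *)
have [|m hm] := @expr_small R z (eps * (1 - z) / 4) z0 z1.
  by rewrite divr_gt0// mulr_gt0//; lra.
pose K1 := (K + m)%N.
exists (mesh K1); first exact: mesh_gt0 T K1.
apply: packing_content_le => X uX pX; have [hX tX] := pX.
have X0 p : p \in X -> 0 < p.2 by move=> /hX [].
have [K'0 hK'0] := mesh_below X0.
pose K' := maxn K1 K'0.
have hK' p : p \in X -> mesh K' < p.2.
  by move=> /hK'0; apply: le_lt_trans; exact/mesh_homo/leq_maxr.
(* The share of [p] assigned to level [k] by its radius, and to a word [t] of length [k + 1] by its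
   centre. Counting a ball in several hulls is harmless for an upper bound. *)
pose F k t (p : R * R) := if [&& mesh k.+1 < p.2, p.2 <= mesh k &
    lo t + L k.+2 <= p.1 <= lo t + L k.+2 + hull k.+1] then p.2 `^ s else 0.
have F0 k t p : 0 <= F k t p by rewrite /F; case: ifP => // _; exact: powR_ge0.
have term p : p \in X -> (2 * p.2) `^ s <=
    2 * \sum_(K1 <= k < K') \sum_(t <- descendants n [::] k.+1) F k t p.
  move=> pX'; have [Ep p0 pK1] := hX p pX'.
  rewrite powRM ?(ltW p0)//; apply: ler_pM; rewrite ?powR_ge0//.
    by rewrite -[leRHS]powRr1// ler_powR// /s; lra.
  have [k [hk k1 k2]] := mesh_between (hK' p pX') pK1.
  have [t ht ht'] := hull_mem T k.+1 Ep.
  apply: (@le_trans _ _ (\sum_(t <- descendants n [::] k.+1) F k t p)).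
    apply: le_trans (ler_big_term ht (fun t => F0 k t p)).
    by rewrite /F k1 k2 ht'.
  apply: (@ler_big_term R nat (index_iota K1 K') (fun k => \sum_(t <- descendants n [::] k.+1) F k t p)).
    by rewrite mem_index_iota.
  by move=> k'; apply: sumr_ge0.
apply: (@le_trans _ _ (\sum_(p <- X) (2 *
    \sum_(K1 <= k < K') \sum_(t <- descendants n [::] k.+1) F k t p))).
  by rewrite !big_seq; apply: ler_sum => p; exact: term.
rewrite -mulr_sumr exchange_big/=.
have cell k t : \sum_(p <- X) F k t p <=
    mesh k `^ s + hull k.+1 * mesh k.+1 `^ (s - 1).
  have H0 := hull_gt0 T k.+1.
  set b := mesh k `^ s / hull k.+1 + mesh k.+1 `^ (s - 1).
  have b0 : 0 <= b by rewrite addr_ge0 ?powR_ge0// divr_ge0 ?powR_ge0// ltW.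
  set a := lo t + L k.+2.
  have h : \sum_(p <- X) F k t p <= \sum_(p <- X | a <= p.1 <= a + hull k.+1)
     b * (Num.min (p.1 + p.2) (a + hull k.+1) - Num.max (p.1 - p.2) a).
    rewrite [leRHS]big_mkcond !big_seq; apply: ler_sum => p pX'.
    rewrite /F -/a; case: ifP => [/and3P[h1 h2 h3]|_].
      rewrite h3; apply: ball_overlap_lower => //; rewrite ?(mesh_gt0 T)//; rewrite /s; lra.
    case: ifP => // /andP[h1 h2]; have p0 := X0 p pX'.
    apply: mulr_ge0 => //.
    by rewrite subr_ge0 ge_max !le_min; apply/andP; split; apply/andP; split; lra.
  apply: (le_trans h); rewrite -mulr_sumr.
  have := is_packing_sum_overlap uX (ltac:(lra) : a <= a + hull k.+1) pX.
  rewrite (_ : a + hull k.+1 - a = hull k.+1); last by ring.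
  move=> h'.
  apply: (@le_trans _ _ (b * hull k.+1)); first by apply: ler_wpM2l.
  by rewrite /b mulrDl divfK ?gt_eqF// [hull _ * _]mulrC.
have level k : (K1 <= k)%N ->
    \sum_(p <- X) \sum_(t <- descendants n [::] k.+1) F k t p <= 2 * z ^+ k.
  move=> K1k; have Kk : (K <= k)%N by apply: leq_trans K1k; exact: leq_addr.
  rewrite exchange_big/=.
  apply: (@le_trans _ _ (\sum_(t <- descendants n [::] k.+1)
     (mesh k `^ s + hull k.+1 * mesh k.+1 `^ (s - 1)))).
    by apply: ler_sum => t _.
  rewrite sum_descendants_cst -/(nwords k.+1) mulrDr mulrA.
  have scale j : (K <= j)%N -> nwords j * hull j * mesh j `^ (s - 1) <= mesh j `^ (e / 2).
    move=> Kj; have -> : e / 2 = e + (s - 1) by rewrite /s; field.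
    rewrite powRD; last by rewrite (gt_eqF (mesh_gt0 T j)) implybT.
    by apply: ler_wpM2r; [exact: powR_ge0|exact/ltW/hP].
  have -> : nwords k.+1 * mesh k `^ s = nwords k * hull k * mesh k `^ (s - 1).
    rewrite -(mulr_powRB1 (ltW (mesh_gt0 T k))); last by rewrite /s; lra.
    by rewrite nwordsS -(mesh_hull T k); ring.
  have h1 := scale k Kk; have h2 := scale k.+1 (leqW Kk).
  have h3 := mesh_pow k; have h4 := mesh_pow k.+1.
  have h5 : z ^+ k.+1 <= z ^+ k by rewrite exprS ler_piMl ?exprn_ge0 ?ltW.
  lra.
apply: (@le_trans _ _ (2 * \sum_(K1 <= k < K') 2 * z ^+ k)).
  rewrite ler_pM2l// !big_nat; apply: ler_sum => k /andP[h _]; exact: level.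
rewrite -mulr_sumr.
have h1 := geometric_tail_le z0 z1 (leq_maxl K1 K'0).
have h2 : z ^+ K1 / (1 - z) <= eps / 4.
  rewrite ler_pdivrMr; last by lra.
  have -> : eps / 4 * (1 - z) = eps * (1 - z) / 4 by ring.
  by apply: le_trans hm; rewrite /K1 exprD ler_piMl ?exprn_ge0 ?exprn_ile1 ?ltW.
rewrite -/K' in h1; lra.
Qed.

End LargeScales.

(** * Images of the cells *)

Section Points.
Context {R : realType} (n : nat -> nat) (c : nat -> R) (lo hi : seq nat -> R).
Context (L Rr sp : nat -> R) (w : R).
Hypothesis T : moran_tree n c lo hi L Rr sp w.
Local Notation mesh := (mesh_size n c L Rr).
Local Notation hull := (hull_length c L Rr).
Local Notation nwords := (@word_count R n).

Definition extend_ones (s : seq nat) m := iter m (fun t => rcons t 1%N) s.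

(** The sum of the series of the left gaps below level [k], written as a supremum because its terms
    are nonnegative. *)
Definition left_offset k : R := sup (range (fun m => \sum_(0 <= j < m) L (k + j).+1)).

(* The leftmost point of the part of the Moran set coded by the extensions of [s].
   Since the left gaps are the same in all intervals of a given level, it is a
   translation of [lo s] by an amount that only depends on the level. *)
Definition left_point (s : seq nat) : R := lo s + left_offset (size s).

Lemma extend_onesP k s m : words n k s ->
  [/\ words n (k + m) (extend_ones s m), prefix s (extend_ones s m) &
      lo (extend_ones s m) = lo s + \sum_(0 <= j < m) L (k + j).+1].
Proof.
move=> hs; elim: m => [|m [IH1 IH2 IH3]] /=.
  by rewrite addn0 big_geq// addr0; split=> //; exact: prefix_refl.
rewrite addnS; split.
- by apply: words_rcons => //=; apply/ltnW/(mt_n T).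
- by apply: prefix_trans IH2 _; exact: prefix_rcons.
- by rewrite (mt_first T IH1) IH3 big_nat_recr//= addrA.
Qed.

(** Nested intervals: the partial sums place the left ends of the cells [s1...1], and each such left
    end is below the right end of any other of these cells. *)
Lemma left_offset_bounds k s m : words n k s ->
  lo (extend_ones s m) <= left_point s <= hi (extend_ones s m).
Proof.
move=> hs; have [hm pm loE] := extend_onesP m hs.
have key j : lo s + \sum_(0 <= i < j) L (k + i).+1 <= hi (extend_ones s m).
  have [hj pj <-] := extend_onesP j hs.
  have len i t : words n i t -> lo t <= hi t.
    by move=> ht; rewrite (mt_len T ht) lerDl ltW// (delta_gt0 T).
  have [jm|mj] := leqP j m.
    have pre : prefix (extend_ones s j) (extend_ones s m).
      by rewrite -(subnK jm) /extend_ones iterD -!/(extend_ones _ _);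
         have [_ ? _] := extend_onesP (m - j) hj.
    by have [? _] := prefix_nested T hj hm pre; apply: le_trans (len _ _ hm).
  have pre : prefix (extend_ones s m) (extend_ones s j).
    by rewrite -(subnK (ltnW mj)) /extend_ones iterD -!/(extend_ones _ _);
       have [_ ? _] := extend_onesP (j - m) hm.
  by have [_ ?] := prefix_nested T hm hj pre; apply: le_trans (len _ _ hj) _.
have ub : has_ubound (range (fun m => \sum_(0 <= j < m) L (k + j).+1)).
  by exists (hi (extend_ones s m) - lo s) => _ [j _ <-]; have := key j; lra.
rewrite /left_point (proj1 hs) loE; apply/andP; split.
  by rewrite lerD2l; apply: ub_le_sup => //; exists m.
rewrite -lerBrDl; apply: ge_sup; first by exists 0, 0%N => //; rewrite big_geq.
by move=> _ [j _ <-]; have := key j; lra.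
Qed.

Lemma left_point_bounds k s : words n k s -> lo s <= left_point s <= lo s + delta c k.
Proof. by move=> hs; have := left_offset_bounds 0 hs; rewrite /= (mt_len T hs). Qed.

Lemma lo_bounds k s : words n k s -> 0 <= lo s /\ hi s <= 1.
Proof.
move=> hs; have h0 : words n 0 [::] by split.
have [] := prefix_nested T h0 hs (prefix0s _).
by rewrite (mt_len T h0) (mt_root T) /delta big_geq// add0r.
Qed.

(** The offsets agree on a level, so only the left ends of the cells matter. Distinct parents may
    touch; leaving out the last child puts a whole sibling, hence a step [sp k], between the
    points. *)
Lemma left_points_separated k s s' i i' : words n k s -> words n k s' ->
  (1 <= i < n k.+1)%N -> (1 <= i' < n k.+1)%N -> rcons s i != rcons s' i' ->
  sp k <= `|left_point (rcons s i) - left_point (rcons s' i')|.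
Proof.
wlog suff W : s s' i i' / words n k s -> words n k s' ->
    (1 <= i < n k.+1)%N -> (1 <= i' < n k.+1)%N ->
    (hi s <= lo s' \/ s = s' /\ (i < i')%N) ->
    sp k <= left_point (rcons s' i') - left_point (rcons s i).
  move=> hs hs' hi_ hi_' ne.
  suff [h|h] : (hi s <= lo s' \/ s = s' /\ (i < i')%N) \/
               (hi s' <= lo s \/ s' = s /\ (i' < i)%N).
  - by rewrite distrC ler_normr W.
  - by rewrite ler_normr W.
  move: ne; have [<-|ss _] := eqVneq s s'.
    have [ii _|ii _|->] := ltngtP i i'; last by rewrite eqxx.
      by left; right.
    by right; right.
  by case: (words_disjoint T hs hs' ss); [left; left|right; left].
move=> hs hs' /andP[i1 i2] /andP[i1' i2'] hss.
have hI : (1 <= i <= n k.+1)%N by rewrite i1 ltnW.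
have hI' : (1 <= i' <= n k.+1)%N by rewrite i1' ltnW.
have hIS : (1 <= i.+1 <= n k.+1)%N by rewrite i2.
rewrite /left_point (proj1 (words_rcons hs hI)) (proj1 (words_rcons hs' hI')).
case: hss => [h|[ss ii]]; last first.
  have := lo_child_lt T (i := i) (j := i') hs'; rewrite -ss i1 ii (ltnW i2') => /(_ isT isT); lra.
have [h1 _] := child_hull T hs' hI'.
have := lo_child_lt T (i := i) (j := i.+1) hs; rewrite i1 ltnS leqnn i2 => /(_ isT isT) h2.
have [_ h3] := child_hull T hs hIS; move: h3; rewrite (mt_len T (words_rcons hs hIS)).
have := mt_L T k; have := mt_R T k; have := delta_gt0 T k.+1.
by move: h; rewrite (mt_len T hs) /hull_length; lra.
Qed.

(** For nondecreasing [g], the distance from [g x] to the nearer of the images of [x - h] and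
    [x + h]; it sets the radius of the ball placed in the image. *)
Definition min_increment (g : R -> R) (h x : R) : R := Num.min (g (x + h) - g x) (g x - g (x - h)).

(** A step between siblings is comparable to [sp k], hence its image to either one-sided increment
    at the left point. The steps add up to a length [hull k - delta c k.+1], at least half the hull,
    and [doubling_lower] compares that with the cell. *)
Lemma children_increments_lower (g : R -> R) (H : R) : doubling H g ->
  exists q C : R, [/\ 0 < q, 0 < C & forall k s, words n k s ->
    (hull k / delta c k) `^ q * (g (hi s) - g (lo s)) <=
    C * \sum_(1 <= i < n k.+1) min_increment g (sp k) (left_point (rcons s i))].
Proof.
move=> hg; have [H1 g_homo _] := hg; have w1 := mt_w T.
have [q [C [q0 C1 hlow]]] := doubling_lower hg.
have wq0 : 0 < w `^ q by rewrite powR_gt0//; lra.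
have tq0 : 0 < 2 `^ q :> R by rewrite powR_gt0.
exists q, (C * 2 `^ q * (C * w `^ q)); split => //.
  by rewrite !mulr_gt0//; lra.
move=> k s hs.
have d0 := delta_gt0 T k; have d1 := delta_gt0 T k.+1; have s0 := sp_gt0 T k.
have H0 := hull_gt0 T k; have Hd := hull_le T k; have spd := mt_sp T k.
have n2 : 2 <= (n k.+1)%:R :> R by rewrite (ler_nat _ 2) (mt_n T).
have Hh : hull k / 2 <= hull k - delta c k.+1 by have := hull_ge T k; nra.
have step i : (1 <= i < n k.+1)%N -> g (lo (rcons s i.+1)) - g (lo (rcons s i)) <=
    C * w `^ q * min_increment g (sp k) (left_point (rcons s i)).
  move=> hin; have hi' : (1 <= i <= n k.+1)%N by have [-> /ltnW] := andP hin.
  have /andP[x1 x2] := left_point_bounds (words_rcons hs hi').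
  have /andP[y1 y2] := mt_step T hs hin.
  have wE : w * sp k / sp k = w by rewrite mulfK ?gt_eqF.
  have sw : sp k <= w * sp k by rewrite ler_peMl// ltW.
  rewrite /min_increment /Num.min; case: ifP => _.
    have := hlow (w * sp k) (lo (rcons s i)) (lo (rcons s i.+1))
      (left_point (rcons s i)) (left_point (rcons s i) + sp k)
      ltac:(lra) ltac:(lra) ltac:(lra) ltac:(lra).
    by rewrite addrAC subrr add0r wE.
  have := hlow (w * sp k) (lo (rcons s i)) (lo (rcons s i.+1))
      (left_point (rcons s i) - sp k) (left_point (rcons s i))
      ltac:(lra) ltac:(lra) ltac:(lra) ltac:(lra).
  have -> : left_point (rcons s i) - (left_point (rcons s i) - sp k) = sp k by ring.
  by rewrite wE.
have total : g (lo (rcons s (n k.+1))) - g (lo (rcons s 1%N)) <=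
    C * w `^ q * \sum_(1 <= i < n k.+1) min_increment g (sp k) (left_point (rcons s i)).
  rewrite -(telescope_sumr (fun i => g (lo (rcons s i))) (ltnW (mt_n T k))).
  by rewrite mulr_sumr !big_nat; apply: ler_sum.
have lastE := lo_last T hs; have firstE := mt_first T hs; have lenE := mt_len T hs.
have h := hlow (delta c k) (lo s) (hi s) (lo (rcons s 1%N)) (lo (rcons s (n k.+1))).
have lenJ : lo (rcons s (n k.+1)) - lo (rcons s 1%N) = hull k - delta c k.+1.
  by rewrite /hull_length; lra.
have L0 := mt_L T k; have R0 := mt_R T k.
have {h} := h ltac:(lra) ltac:(lra) ltac:(lra) ltac:(lra).
rewrite lenJ => h.
have ratio : (hull k / delta c k) `^ q * (delta c k / (hull k - delta c k.+1)) `^ q <= 2 `^ q.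
  have e1 : 0 <= hull k / delta c k by rewrite divr_ge0 ?ltW.
  have e2 : 0 <= delta c k / (hull k - delta c k.+1) by rewrite divr_ge0; lra.
  rewrite -powRM//; apply: ge0_ler_powR; rewrite ?nnegrE ?(ltW q0)//; first exact: mulr_ge0.
  rewrite mulrA divfK ?gt_eqF// ler_pdivrMr; lra.
set Z := (hull k / delta c k) `^ q in ratio *.
have Z0 : 0 <= Z by exact: powR_ge0.
apply: (le_trans (ler_wpM2l Z0 h)).
set D := g (lo (rcons s (n k.+1))) - g (lo (rcons s 1%N)) in total h *.
have D0 : 0 <= D by rewrite subr_ge0; apply: g_homo; lra.
rewrite -[leRHS]mulrA; apply: (@le_trans _ _ (C * 2 `^ q * D)).
  set X := (delta c k / _) `^ q in ratio *.
  have -> : Z * (C * X * D) = C * (Z * X) * D by ring.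
  by apply: ler_wpM2r => //; apply: ler_wpM2l => //; lra.
by rewrite ler_pM2l ?mulr_gt0//; lra.
Qed.

Lemma nwords_ge1 k : 1 <= nwords k.
Proof.
elim: k => [|k IH]; first by rewrite /word_count big_geq.
rewrite nwordsS mulr_ege1// ler1n; exact: ltnW (mt_n T k).
Qed.

Lemma nwords_delta_le1 k : nwords k * delta c k <= 1.
Proof.
elim: k => [|k IH]; first by rewrite /word_count /delta !big_geq// mulr1.
have p1 : 0 <= nwords k * delta c k by rewrite mulr_ge0 ?ltW ?(nwords_gt0 T) ?(delta_gt0 T).
have p2 : 0 <= (n k.+1)%:R * c k.+1 by rewrite mulr_ge0// ltW// (mt_c T).
by rewrite nwordsS deltaS mulrACA mulr_ile1// ltW// (mt_nc T).
Qed.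

(** The one-level bounds multiply along the tree. The factors of the levels above [s] are at most 1,
    so including them only weakens the base case and makes the bound uniform in [t]. *)
Lemma descendants_image_lower (g : R -> R) (H eta : R) : doubling H g -> 0 < eta ->
  exists2 Q : R, 0 < Q & forall t s m, words n t s ->
    nwords (t + m) `^ (- eta) * (nwords (t + m) * delta c (t + m)) `^ Q * (g (hi s) - g (lo s))
    <= \sum_(s' <- descendants n s m) (g (hi s') - g (lo s')).
Proof.
move=> hg eta0; have [H1 g_homo _] := hg.
have [Q [Q0 hQ]] := spaced_children_lower hg (mt_w T) eta0.
exists Q => // t s m hs; elim: m => [|m IH].
  rewrite addn0 big_seq1 ler_piMl//.
    rewrite subr_ge0; apply: g_homo; rewrite (mt_len T hs) lerDl ltW//; exact: delta_gt0 T _.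
  rewrite mulr_ile1 ?powR_ge0//.
    rewrite powRN invf_le1; last by rewrite powR_gt0// (nwords_gt0 T).
    by rewrite -[leLHS](powRr0 (nwords t)) ler_powR ?nwords_ge1// ltW.
  have h0 : 0 < nwords t * delta c t by rewrite mulr_gt0 ?(nwords_gt0 T)// (delta_gt0 T).
  by rewrite -[leRHS](powRr0 (nwords t * delta c t)) ger_powR ?(ltW Q0)// h0 nwords_delta_le1.
rewrite (big_descendantsS _ _ hs) addnS nwordsS deltaS.
set k := (t + m)%N in IH *.
have N0 := nwords_gt0 T k; have d0 := delta_gt0 T k; have n0 := n_gt0 T k; have c0 := mt_c T k.
rewrite mulrACA !powRM ?mulr_ge0 ?(ltW N0) ?(ltW d0) ?(ltW n0) ?(ltW c0)//.
set F := (n k.+1)%:R `^ (- eta) * ((n k.+1)%:R `^ Q * c k.+1 `^ Q).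
have F0 : 0 <= F by rewrite !mulr_ge0 ?powR_ge0.
apply: (@le_trans _ _ (F * \sum_(s' <- descendants n s m) (g (hi s') - g (lo s')))).
  apply: le_trans (ler_wpM2l F0 IH); rewrite powRM ?(ltW N0) ?(ltW d0)//.
  by rewrite /F le_eqVlt; apply/orP; left; apply/eqP; ring.
rewrite mulr_sumr !big_seq; apply: ler_sum => s' /(descendants_words hs) [hs' _].
have := hQ _ _ _ _ _ (moran_spaced T hs').
rewrite powRM ?(ltW n0) ?(ltW c0)// => h; apply: (le_trans h).
rewrite /image_sum !big_nat; apply: ler_sum => i hin.
have hi' : (1 <= i <= n k.+1)%N by move: hin; rewrite ltnS.
by rewrite (mt_len T (words_rcons hs' hi')) (mt_len T hs') deltaS addrAC subrr add0r [c _ * _]mulrC.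
Qed.

(** Since [nwords k * delta c k <= 1], the product [nwords k * hull k] is at most
    [hull k / delta c k], and it is also at most [nwords k * delta c k]: one power of it replaces
    both factors. Likewise [nwords k * mesh k <= 1] replaces the counting factor. *)
Lemma increments_lower (g : R -> R) (H eta : R) : doubling H g -> 0 < eta ->
  exists Q C : R, [/\ 0 < Q, 0 < C & forall t s m, words n t s ->
    C * mesh (t + m) `^ eta * (nwords (t + m) * hull (t + m)) `^ Q * (g (hi s) - g (lo s)) <=
    \sum_(s' <- descendants n s m) \sum_(1 <= i < n (t + m).+1)
       min_increment g (sp (t + m)) (left_point (rcons s' i))].
Proof.
move=> hg eta0; have [H1 g_homo _] := hg.
have [q [C [q0 C0 hq]]] := children_increments_lower hg.
have [Q Q0 hQ] := descendants_image_lower hg eta0.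
exists (q + Q), C^-1; split; [lra|by rewrite invr_gt0|move=> t s m hs].
set k := (t + m)%N.
have N0 := nwords_gt0 T k; have d0 := delta_gt0 T k; have H0 := hull_gt0 T k.
have Nd := nwords_delta_le1 k; have Hd := hull_le T k.
have D0 : 0 <= g (hi s) - g (lo s).
  by rewrite subr_ge0; apply: g_homo; rewrite (mt_len T hs) lerDl ltW// (delta_gt0 T).
rewrite -!mulrA ler_pdivrMl//.
have h1 : mesh k `^ eta <= nwords k `^ (- eta).
  rewrite powRN -[leRHS]mul1r ler_pdivlMr ?powR_gt0// -powRM ?(ltW N0) ?(ltW (mesh_gt0 T k))//.
  have MN0 : 0 < mesh k * nwords k by rewrite mulr_gt0// (mesh_gt0 T).
  rewrite -[leRHS](powRr0 (mesh k * nwords k)) ger_powR ?(ltW eta0)// MN0.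
  by have := mesh_le_delta T k; nra.
have h2 : (nwords k * hull k) `^ (q + Q) <= (hull k / delta c k) `^ q * (nwords k * delta c k) `^ Q.
  have P0 : 0 < nwords k * hull k by rewrite mulr_gt0.
  rewrite powRD; last by rewrite (gt_eqF P0) implybT.
  apply: ler_pM; rewrite ?powR_ge0//; apply: ge0_ler_powR;
    rewrite ?nnegrE ?(ltW q0) ?(ltW Q0) ?mulr_ge0 ?invr_ge0 ?(ltW N0) ?(ltW d0) ?(ltW H0)//.
    by rewrite ler_pdivlMr// mulrAC ler_piMl// ltW.
  by rewrite ler_pM2l.
have := hQ t s m hs; rewrite -/k => h3.
apply: (@le_trans _ _ ((hull k / delta c k) `^ q *
    \sum_(s' <- descendants n s m) (g (hi s') - g (lo s')))).
  apply: le_trans (ler_wpM2l (powR_ge0 _ _) h3).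
  set a := (hull k / _) `^ q in h2 *; set b := (nwords k * delta c k) `^ Q in h2 *.
  have -> : a * (nwords k `^ (- eta) * b * (g (hi s) - g (lo s))) =
    nwords k `^ (- eta) * (a * b) * (g (hi s) - g (lo s)) by ring.
  by rewrite [leLHS]mulrA; apply: ler_wpM2r => //; apply: ler_pM; rewrite ?powR_ge0.
rewrite !mulr_sumr !big_seq; apply: ler_sum => s' /(descendants_words hs) [hs' _].
exact: hq.
Qed.

End Points.

(** * Quasisymmetric maps as doubling functions *)

(** Points [a], [b] equidistant from [x] reduce the definition to the value [eta 1]. A continuous
    injection of the line is monotone, so [g] is [f] or its opposite. *)
Lemma quasisymmetric_doubling {R : realType} (f : R -> R) : quasisymmetric f ->
  continuous f /\ exists (g : R -> R) (H : R),
    [/\ doubling H g, {homo g : x y / x < y} & forall x y, `|f x - f y| = `|g x - g y|].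
Proof.
move=> [[f' [_ fK _ fc _]] [eta [_ heta]]].
have fcont : continuous f by apply/continuous_subspace_setT.
split=> //.
have ratio a b x : a != b -> `|x - a| = `|x - b| -> a != x ->
    `|f x - f a| <= Num.max 1 (eta 1) * `|f x - f b|.
  move=> ab xab ax.
  have xa0 : `|x - a| != 0 by rewrite normr_eq0 subr_eq0 eq_sym.
  have bx : b != x by rewrite eq_sym -subr_eq0 -normr_eq0 -xab.
  have := heta a b x ab ax bx; rewrite -xab divff// ler_pdivrMr; last first.
    rewrite normr_gt0 subr_eq0; apply/eqP => /(congr1 f'); rewrite !fK// => xb.
    by rewrite xb eqxx in bx.
  by move=> h; apply: (le_trans h); apply: ler_wpM2r => //; rewrite le_max lexx orbT.
have sym x h : 0 < h ->
    `|f x - f (x + h)| <= Num.max 1 (eta 1) * `|f x - f (x - h)| /\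
    `|f x - f (x - h)| <= Num.max 1 (eta 1) * `|f x - f (x + h)|.
  move=> h0; have d1 : `|x - (x + h)| = `|x - (x - h)|.
    have -> : x - (x + h) = - h by ring.
    have -> : x - (x - h) = h by ring.
    by rewrite normrN.
  have ne : x + h != x - h by apply/eqP; lra.
  split; apply: ratio => //.
  - by apply/eqP; lra.
  - by rewrite eq_sym.
  - by apply/eqP; lra.
have mk g : {homo g : x y / x < y} -> (forall x y, `|f x - f y| = `|g x - g y|) ->
    doubling (Num.max 1 (eta 1)) g.
  move=> gm fg; split; first by rewrite le_max lexx.
    by move=> x y; rewrite le_eqVlt => /orP[/eqP->//|/gm/ltW].
  move=> x h h0; have [] := sym x h h0; rewrite !fg.
  have e1 : `|g x - g (x + h)| = g (x + h) - g x.
    by rewrite distrC gtr0_norm// subr_gt0; apply: gm; lra.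
  have e2 : `|g x - g (x - h)| = g x - g (x - h).
    by rewrite gtr0_norm// subr_gt0; apply: gm; lra.
  by rewrite e1 e2.
have inj : {in `]-oo, +oo[ &, injective f}.
  by move=> x y _ _ /(congr1 f'); rewrite !fK.
have fcI : {within [set` `]-oo, +oo[ ], continuous f} by rewrite set_itvNyy; exact: fc.
have [inc|dec] := itv_continuous_inj_mono fcI inj.
  have fm : {homo f : x y / x < y} by move=> x y; apply: inc; rewrite in_itv.
  by exists f, (Num.max 1 (eta 1)); split=> //; exact: mk.
have fm : {homo (fun x => - f x) : x y / x < y}.
  by move=> x y xy; rewrite ltrN2; apply: dec => //; rewrite in_itv.
have fg x y : `|f x - f y| = `|- f x - - f y| by rewrite -opprD normrN.
by exists (fun x => - f x), (Num.max 1 (eta 1)); split=> //; exact: mk.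
Qed.

(** * Packings of the image *)

Lemma closure_approx {R : realType} (G : set R) (y e : R) : closure G y -> 0 < e ->
  exists2 z, G z & `|z - y| < e.
Proof.
move=> Gy e0; have [z [Gz yz]] := Gy _ (nbhsx_ballx y e e0).
by exists z => //; rewrite distrC.
Qed.

(** For [x <= y], the right increment at [x] and the left increment at [y] both fit between [g x]
    and [g y]. *)
Lemma increments_separated {R : realType} (g : R -> R) (h x y : R) :
  {homo g : x y / x <= y} -> h <= `|x - y| ->
  Num.max (min_increment g h x) (min_increment g h y) <= `|g x - g y|.
Proof.
move=> gm; wlog xy : x y / x <= y => [W|].
  move=> hxy; have [xy|yx] := leP x y; first exact: W.
  by rewrite maxC distrC; apply: W; [exact: ltW|rewrite distrC].
rewrite distrC ger0_norm ?subr_ge0// => hxy.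
rewrite distrC ger0_norm ?subr_ge0 ?gm// ge_max !ge_min.
have h1 : g (x + h) <= g y by apply: gm; lra.
have h2 : g x <= g (y - h) by apply: gm; lra.
by apply/andP; split; apply/orP; [left|right]; lra.
Qed.

Section Main.
Context {R : realType} (n : nat -> nat) (c : nat -> R) (lo hi : seq nat -> R).
Context (L Rr sp : nat -> R) (w : R).
Hypothesis T : moran_tree n c lo hi L Rr sp w.
Local Notation mesh := (mesh_size n c L Rr).
Local Notation hull := (hull_length c L Rr).
Local Notation nwords := (@word_count R n).
Local Notation left_point := (left_point lo L).
Local Notation E := (moran_set n lo hi).

Lemma mesh_powR_small (a b : R) : 0 < a -> 0 < b ->
  exists K, forall k, (K <= k)%N -> mesh k `^ a <= b.
Proof.
move=> a0 b0; have [|K hK] := mesh_small T (e := b `^ a^-1); first exact: powR_gt0.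
exists K => k Kk; have -> : b = (b `^ a^-1) `^ a.
  by rewrite -powRrM mulVf ?gt_eqF// powRr1// ltW.
by apply: ge0_ler_powR; rewrite ?nnegrE ?powR_ge0 ?(ltW a0) ?(ltW (mesh_gt0 T k)) ?hK.
Qed.

(** The points [f (left_point u)] need only be limits of [G]: each centre is moved into [G] by less
    than its radius, and the separation survives. *)
Lemma packing_content_dense (f g : R -> R) (G : set R) t s m (a d : R) :
  {homo g : x y / x < y} -> (forall x y, `|f x - f y| = `|g x - g y|) ->
  words n t s ->
  (forall k s', words n k s' -> prefix s s' -> closure G (f (left_point s'))) ->
  (forall x, 0 <= x -> x <= 1 -> min_increment g (sp (t + m)) x <= d) ->
  ((\sum_(s' <- descendants n s m) \sum_(1 <= i < n (t + m).+1)
     (min_increment g (sp (t + m)) (left_point (rcons s' i)) / 4) `^ a)%:E <=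
    packing_content a d G)%E.
Proof.
move=> gm fg hs dense hd; set k := (t + m)%N in hd *.
pose W := [seq rcons s' i | s' <- descendants n s m, i <- iota 1 (n k.+1).-1].
(* An eighth of the increment: the two displacements and the two radii together take at most half of
   the distance between the images. *)
pose rad s' := min_increment g (sp k) (left_point s') / 8.
have gm' : {homo g : x y / x <= y} by move=> x y; rewrite le_eqVlt => /orP[/eqP->//|/gm/ltW].
have memW u : u \in W -> exists s' i,
    [/\ words n k s', prefix s s', (1 <= i < n k.+1)%N & u = rcons s' i].
  move=> /allpairsPdep[s' [i [hs' hi' ->]]]; have [h1 h2] := descendants_words hs hs'.
  exists s', i; split=> //; move: hi'; rewrite mem_iota.
  by have := mt_n T k; lia.
have uW : uniq W.
  apply: allpairs_uniq => //; [exact: descendants_uniq|exact: iota_uniq|].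
  by move=> [u i] [v j] _ _ /= /rcons_inj [-> ->].
have wordW u : u \in W -> words n k.+1 u /\ prefix s u.
  move=> /memW [s' [i [hs' pre /andP[i1 i2] ->]]]; split.
    by apply: (words_rcons hs'); rewrite i1 (ltnW i2).
  exact: prefix_trans pre (prefix_rcons _ _).
have inc0 x : 0 < min_increment g (sp k) x.
  by have := sp_gt0 T k => s0; rewrite lt_min !subr_gt0 !gm//; lra.
have : forall u, exists z, u \in W -> G z /\ `|z - f (left_point u)| < rad u.
  move=> u; have [uW'|_] := boolP (u \in W); last by exists 0.
  have [hu pu] := wordW u uW'.
  have [|z Gz zr] := closure_approx (dense _ _ hu pu) (e := rad u); last by exists z.
  by rewrite divr_gt0.
move=> /choice [z hz].
have sumE : \sum_(s' <- descendants n s m) \sum_(1 <= i < n k.+1)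
     (min_increment g (sp k) (left_point (rcons s' i)) / 4) `^ a =
   \sum_(u <- W) (2 * rad u) `^ a.
  rewrite big_allpairs_dep; apply: eq_bigr => s' _; rewrite /index_iota subn1.
  by apply: eq_bigr => i _; congr (_ `^ _); rewrite /rad; field.
rewrite sumE; apply: (packing_content_ge (z := z)) => //.
  move=> u uW'; have [Gz _] := hz u uW'; have [hu _] := wordW u uW'.
  have /andP[x1 x2] := left_point_bounds T hu; have [y1 y2] := lo_bounds T hu.
  rewrite (mt_len T hu) in y2.
  split=> //; first by rewrite divr_gt0.
  have := hd (left_point u) ltac:(lra) ltac:(lra); have := inc0 (left_point u).
  by rewrite /rad; lra.
move=> u v uW' vW' uv.
have [_ zu] := hz u uW'; have [_ zv] := hz v vW'.
have [su [iu [hsu _ hiu uE]]] := memW u uW'; have [sv [iv [hsv _ hiv vE]]] := memW v vW'.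
have sep : sp k <= `|left_point u - left_point v|.
  by rewrite uE vE; apply: (left_points_separated T) => //; rewrite -uE -vE.
have := increments_separated gm' sep; rewrite -fg ge_max => /andP[h1 h2].
have : `|f (left_point u) - f (left_point v)| <=
    `|z u - f (left_point u)| + `|z u - z v| + `|z v - f (left_point v)|.
  rewrite [`|z u - f _|]distrC -addrA.
  have -> : f (left_point u) - f (left_point v) =
    (f (left_point u) - z u) + ((z u - z v) + (z v - f (left_point v))) by ring.
  by apply: (le_trans (ler_normD _ _)); rewrite lerD2l ler_normD.
have := inc0 (left_point u); have := inc0 (left_point v).
move: zu zv; rewrite /rad; lra.
Qed.

(** The radii sum up to at least a constant times [mesh k ^ (b / 2)], while each [r ^ (1 - a)] is at
    most a constant times [mesh k ^ b]. So the sum of the [r ^ a] grows at least like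
    [mesh k ^ (- b / 2)]. *)
Lemma packing_premeasure_dense (f g : R -> R) (H : R) (G : set R) t s (a : R) :
  doubling H g -> {homo g : x y / x < y} -> (forall x y, `|f x - f y| = `|g x - g y|) ->
  packing_dim E = 1%E -> words n t s ->
  (forall k s', words n k s' -> prefix s s' -> closure G (f (left_point s'))) ->
  0 <= a -> a < 1 -> packing_premeasure a G = +oo%E.
Proof.
move=> hg gm fg dimE hs dense a0 a1; have [H1 gm' _] := hg.
have [p [C [p0 C0 holder]]] := doubling_holder hg.
pose b := p * (1 - a); have b0 : 0 < b by rewrite mulr_gt0//; lra.
have [|Q [D [Q0 D0 hlow]]] := increments_lower T hg (eta := b / 4); first lra.
(* Then [(nwords k * hull k) ^ Q] loses at most [mesh k ^ (b / 4)], as much as the exponent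
   [eta = b / 4] does. *)
pose e := Num.min 2^-1 (b / 4 / Q).
have e0 : 0 < e by rewrite lt_min invr_gt0 ltr0n divr_gt0//; lra.
have e1 : e < 1 by rewrite gt_min; apply/orP; left; lra.
have eQ : e * Q <= b / 4.
  by rewrite -ler_pdivlMr// ge_min lexx orbT.
pose A := C * 2 `^ p; have A0 : 0 < A by rewrite mulr_gt0 ?powR_gt0.
have inc k x : (1 <= k)%N -> 0 <= x -> x <= 1 -> min_increment g (sp k) x <= A * mesh k `^ p.
  move=> k1 x0 x1; have s0 := sp_gt0 T k; have sm := sp_le_mesh T k.
  (* Level at least 1 makes [sp k <= 1], so that [x + sp k] stays in the range of the Hoelder
     bound. *)
  have m1 : mesh k <= 2^-1 by apply: le_trans (mesh_homo T k1) _; have := mesh_le T 1; rewrite expr1.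
  apply: (@le_trans _ _ (C * (x + sp k - x) `^ p)).
    apply: (@le_trans _ _ (g (x + sp k) - g x)); first by rewrite ge_min lexx.
    by apply: holder; lra.
  rewrite /A -mulrA -powRM//; last exact: ltW (mesh_gt0 T k).
  rewrite ler_pM2l//; apply: ge0_ler_powR; rewrite ?nnegrE ?(ltW p0)//; [lra| |lra].
  by have := mesh_gt0 T k; lra.
apply: packing_premeasure_eqy => d B d0.
pose Dg := g (hi s) - g (lo s).
have Dg0 : 0 < Dg by rewrite subr_gt0 gm// (mt_len T hs) ltrDl (delta_gt0 T).
pose M := D * Dg / (4 * A `^ (1 - a)).
have M0 : 0 < M by rewrite divr_gt0 ?mulr_gt0// powR_gt0.
have B0 : 0 < Num.max B 1 by rewrite lt_max ltr01 orbT.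
have [|K1 hK1] := mesh_powR_small (a := p) (b := d / A) p0; first exact: divr_gt0.
have [||K2 hK2] := mesh_powR_small (a := b / 2) (b := M / Num.max B 1); [lra|exact: divr_gt0|].
(* A level with a large total hull length, deep enough for radii below [d], for a sum above [B], and
   for lying below [s]. *)
have [k Kk hk] := packing_dim1_nwords_hull T dimE e0 e1 (maxn (maxn K1 K2) t.+1).
move: Kk; rewrite !geq_max -andbA => /and3P[k1 k2 k3].
have kt : k = (t + (k - t))%N by rewrite subnKC// ltnW.
have k0 : (1 <= k)%N by apply: leq_trans k3.
have incd x : 0 <= x -> x <= 1 -> min_increment g (sp k) x <= d.
  move=> x0 x1; apply: (le_trans (inc k x k0 x0 x1)).
  by rewrite mulrC -ler_pdivlMr// hK1.
rewrite kt in incd; have := packing_content_dense a gm fg hs dense incd.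
apply: le_trans; rewrite lee_fin; rewrite -kt.
have := hlow t s (k - t)%N hs; rewrite -kt => {}hlow.
have m0 := mesh_gt0 T k.
set S := \sum_(_ <- _) _ in hlow.
set N := Num.max B 1 in B0 hK2.
have mb : 0 < mesh k `^ (b / 2) by exact: powR_gt0.
have S1 : D * mesh k `^ (b / 2) * Dg <= S.
  apply: le_trans hlow; rewrite ler_pM2r// -mulrA ler_pM2l//.
  have -> : b / 2 = b / 4 + b / 4 by field.
  rewrite powRD; last by rewrite (gt_eqF m0) implybT.
  apply: ler_pM; rewrite ?powR_ge0//.
  apply: (@le_trans _ _ ((mesh k `^ e) `^ Q)).
    by rewrite -powRrM ger_powR// m0 (mesh_le1 T).
  by apply: ge0_ler_powR; rewrite ?nnegrE ?powR_ge0 ?(ltW Q0) ?mulr_ge0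
    ?(ltW (hull_gt0 T k)) ?(ltW (nwords_gt0 T k)).
set q := A `^ (1 - a) * mesh k `^ b.
have q0 : 0 < q by rewrite mulr_gt0 ?powR_gt0.
have term x : 0 <= x -> x <= 1 -> min_increment g (sp k) x / 4 <=
    q * (min_increment g (sp k) x / 4) `^ a.
  move=> x0 x1; set r := min_increment _ _ _ / 4.
  have i0 : 0 < min_increment g (sp k) x.
    by have := sp_gt0 T k => s0; rewrite lt_min !subr_gt0 !gm//; lra.
  have r0 : 0 < r by rewrite divr_gt0.
  have rE : r `^ (1 - a) * r `^ a = r.
    by rewrite -powRD ?subrK ?powRr1 ?(ltW r0)// (gt_eqF r0) implybT.
  rewrite -[leLHS]rE.
  apply: ler_wpM2r; first exact: powR_ge0.
  rewrite /q /b powRrM -powRM ?(ltW A0) ?powR_ge0//.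
  have Am : 0 <= A * mesh k `^ p by apply: mulr_ge0; [exact: ltW|exact: powR_ge0].
  apply: ge0_ler_powR; rewrite ?nnegrE ?(ltW r0) ?Am//; first lra.
  by have := inc k x k0 x0 x1; rewrite /r; lra.
have S2 : S / 4 <= q * \sum_(s' <- descendants n s (k - t)) \sum_(1 <= i < n k.+1)
     (min_increment g (sp k) (left_point (rcons s' i)) / 4) `^ a.
  rewrite /S mulr_suml mulr_sumr !big_seq; apply: ler_sum => s' hs'.
  have [hw _] := descendants_words hs hs'; rewrite -kt in hw.
  rewrite mulr_suml mulr_sumr !big_nat; apply: ler_sum => i /andP[i1 i2].
  have hu : words n k.+1 (rcons s' i) by apply: (words_rcons hw); rewrite i1 (ltnW i2).
  have /andP[h1 h2] := left_point_bounds T hu; have [h3] := lo_bounds T hu.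
  by rewrite (mt_len T hu) => h4; apply: term; lra.
apply: (@le_trans _ _ N); first by rewrite le_max lexx.
rewrite -(ler_pM2l q0); apply: le_trans S2.
apply: (@le_trans _ _ (D * mesh k `^ (b / 2) * Dg / 4)); last by rewrite ler_pM2r// invr_gt0.
have hM := hK2 k k2; rewrite ler_pdivlMr// in hM.
rewrite /q; have -> : mesh k `^ b = mesh k `^ (b / 2) * mesh k `^ (b / 2).
  rewrite -powRD; last by rewrite (gt_eqF m0) implybT.
  by congr (_ `^ _); field.
have AA : 0 < A `^ (1 - a) by exact: powR_gt0.
have -> : D * mesh k `^ (b / 2) * Dg / 4 = A `^ (1 - a) * mesh k `^ (b / 2) * M.
  by rewrite /M; field; rewrite gt_eqF.
have -> : A `^ (1 - a) * (mesh k `^ (b / 2) * mesh k `^ (b / 2)) * N =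
  A `^ (1 - a) * mesh k `^ (b / 2) * (mesh k `^ (b / 2) * N) by ring.
by rewrite ler_pM2l// mulr_gt0.
Qed.

End Main.

(** * Baire category and the dimension of the image *)

Section Baire.
Context {R : realType} (n : nat -> nat) (c : nat -> R) (lo hi : seq nat -> R).
Context (L Rr sp : nat -> R) (w : R).
Hypothesis T : moran_tree n c lo hi L Rr sp w.
Local Notation left_point := (left_point lo L).
Local Notation E := (moran_set n lo hi).

Lemma words_take k s m : words n k s -> (m <= k)%N -> words n m (take m s).
Proof.
move=> [sk hs] mk; split; first by rewrite size_takel// sk.
by move=> j jm; rewrite nth_take//; apply: hs; exact: leq_trans mk.
Qed.

Lemma nested_words_point (u : nat -> seq nat) :
  (forall i, words n (size (u i)) (u i)) ->
  (forall i, prefix (u i) (u i.+1)) -> (forall i, (size (u i) < size (u i.+1))%N) ->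
  exists2 x, E x & forall i, lo (u i) <= x <= hi (u i).
Proof.
move=> wu pu su.
have pre i j : (i <= j)%N -> prefix (u i) (u j).
  move=> /subnK <-; elim: (j - i)%N => [|m IH]; first exact: prefix_refl.
  exact: prefix_trans IH (pu _).
have len i : lo (u i) <= hi (u i).
  by rewrite (mt_len T (wu i)) lerDl ltW// (delta_gt0 T).
have cross i j : lo (u i) <= hi (u j).
  have [ij|/ltnW ji] := leqP i j.
    by have [h _] := prefix_nested T (wu i) (wu j) (pre i j ij); exact: le_trans h (len j).
  by have [_ h] := prefix_nested T (wu j) (wu i) (pre j i ji); exact: le_trans (len i) h.
have inI i : lo (u i) <= sup (range (fun i => lo (u i))) <= hi (u i).
  apply/andP; split.
    by apply: ub_le_sup; [exists (hi (u i)) => _ [j _ <-]|exists i].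
  by apply: ge_sup; [exists (lo (u i)), i|move=> _ [j _ <-]].
exists (sup (range (fun i => lo (u i)))) => // k _.
have ks : (k <= size (u k))%N.
  by elim: k => [//|k IH]; exact: leq_ltn_trans IH (su k).
(* The lengths increase strictly, so [u k] has at least [k] letters and its prefix codes a cell of
   level [k] around the point. *)
exists (take k (u k)); first exact: words_take (wu k) ks.
have [h1 h2] := prefix_nested T (words_take (wu k) ks) (wu k) (prefix_take _ _).
by have /andP[h3 h4] := inI k; rewrite /= in_itv/= (le_trans h1 h3) (le_trans h4 h2).
Qed.

(* Baire category: otherwise one could choose nested cells, the image of the
   [i]-th one being disjoint from [G i]. *)
Lemma moran_cover_dense (f : R -> R) (G : (set R)^nat) : continuous f ->
  f @` E `<=` \bigcup_i G i ->
  exists i t s, words n t s /\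
    forall k s', words n k s' -> prefix s s' -> closure (G i) (f (left_point s')).
Proof.
move=> fc cover; apply: contrapT => hno.
(* The word hypothesis stands under the existential so that [choice] yields a function on all
   pairs. *)
have step (q : nat * seq nat) : exists s', words n (size q.2) q.2 ->
    [/\ words n (size s') s', prefix q.2 s', (size q.2 < size s')%N &
        forall x, lo s' <= x <= hi s' -> ~ G q.1 (f x)].
  case: q => i s /=; have [hs|hs] := pselect (words n (size s) s); last by exists s.
  have [k [s1 [hs1 pre ncl]]] : exists k s1, [/\ words n k s1, prefix s s1 &
      ~ closure (G i) (f (left_point s1))].
    apply: contrapT => h; apply: hno; exists i, (size s), s; split=> // k s1 hs1 pre.
    by apply: contrapT => ncl; apply: h; exists k, s1.
  move: ncl; rewrite /closure /= => /existsNP[B] /not_implyP[Bf GB].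
  have [e /= e0 he] := (nbhs_ballP _ _).1 (fc (left_point s1) B Bf).
  (* The new cell contains [left_point s1] and has length at most [e / 2], so [f] maps all of it
     into [B], which misses [G i]; [m.+1] makes the word strictly longer. *)
  have [|||m hm] := @expr_small R 2^-1 (e / 2); [lra|lra|lra|].
  have [hm1 hm2 _] := extend_onesP T m.+1 hs1.
  exists (extend_ones s1 m.+1) => _; split.
  - by rewrite (proj1 hm1).
  - exact: prefix_trans pre hm2.
  - rewrite (proj1 hm1) addnS ltnS; have /size_prefix := pre.
    by rewrite (proj1 hs1) => /leq_trans; apply; exact: leq_addr.
  move=> x xI Gx; apply: GB; exists (f x); split=> //; apply: he.
  have pI := left_offset_bounds T m.+1 hs1.
  have := delta_le T (k + m.+1); move: xI pI; rewrite (mt_len T hm1) => /andP[x1 x2] /andP[p1 p2] hd.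
  have : 2^-1 ^+ (k + m.+1) <= 2^-1 ^+ m :> R.
    by apply: ler_wiXn2l; [lra|lra|lia].
  by move=> he'; rewrite /ball/= ltr_norml; apply/andP; split; lra.
have [nx hnx] := choice step.
(* The image of the cell [u i.+1] misses [G i]. *)
pose u := fix u i := if i is j.+1 then nx (j, u j) else [::].
have wu i : words n (size (u i)) (u i).
  by elim: i => [|i IH]; [split|case: (hnx (i, u i) IH)].
have [||x Ex xI] := nested_words_point wu.
- by move=> i; case: (hnx (i, u i) (wu i)).
- by move=> i; case: (hnx (i, u i) (wu i)).
have [j _ Gx] : (\bigcup_i G i) (f x) by apply: cover; exists x.
by case: (hnx (j, u j) (wu j)) => _ _ _ /(_ x (xI j.+1)); apply.
Qed.

(** The upper bound is boundedness of the image. For the lower one, every countable cover has a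
    member dense in the image of a cell, whose premeasure is infinite for each exponent below 1. *)
Lemma quasisymmetric_image_dim1 (f : R -> R) : packing_dim E = 1%E ->
  quasisymmetric f -> packing_dim (f @` E) = 1%E.
Proof.
move=> dimE /quasisymmetric_doubling [fc [g [H [hg gm fg]]]].
have [_ gm' _] := hg.
apply/eqP; rewrite eq_le; apply/andP; split.
  have g01 : g 0 <= g 1 by apply: gm'; exact: ler01.
  apply: (@packing_dim_bounded_le1 R _ (f 0 - (g 1 - g 0)) (f 0 + (g 1 - g 0))); first lra.
  move=> _ [x Ex <-].
  have [s0 /= hs0] := Ex 0%N I; rewrite !in_itv/= => /andP[x1 x2].
  have [y1 y2] := lo_bounds T hs0.
  have : `|f x - f 0| <= g 1 - g 0.
    rewrite fg ger0_norm; last by rewrite subr_ge0; apply: gm'; lra.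
    by apply: lerB => //; apply: gm'; lra.
  by rewrite ler_norml => /andP[h1 h2]; apply/andP; split; lra.
apply: packing_dim_ge => a a0 a1; rewrite (packing_measure_eqy (s := a)) // => G cover.
have [i [t [s [hs dense]]]] := moran_cover_dense fc cover.
by exists i; exact: (packing_premeasure_dense T hg gm fg dimE hs dense).
Qed.

End Baire.

Theorem theorem2 (R : realType) (n : nat -> nat) (c : nat -> R)
    (hn : forall k, (1 <= k)%N -> (2 <= n k)%N)
    (hc : forall k, (1 <= k)%N -> 0 < c k)
    (hnc : forall k, (1 <= k)%N -> (n k)%:R * c k < 1)
    (lo hi : seq nat -> R) (E : set R)
    (hI : moran_structure n c lo hi)
    (hE : E = moran_set n lo hi)
    (Lseq Rseq : nat -> R)
    (hL0 : forall k, (1 <= k)%N -> 0 <= Lseq k)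
    (hR0 : forall k, (1 <= k)%N -> 0 <= Rseq k)
    (hL : forall k sigma, words n k sigma ->
       gap n lo hi sigma 0 = Lseq k.+1)
    (hR : forall k sigma, words n k sigma ->
       gap n lo hi sigma (n k.+1) = Rseq k.+1)
    (w1 w2 : R) (hw1 : 0 < w1) (hw2 : 0 < w2)
    (hAB : forall k, (1 <= k)%N ->
       nu_max n lo hi k <= w1 * delta c k \/
       nu_max n lo hi k <= w2 * nu_min n lo hi k)
    (hdim : packing_dim E = 1%E) :
  (forall f : R -> R, quasisymmetric f -> packing_dim (f @` E) = 1%E) /\
  qs_packing_minimal E.
Proof.
have T := moran_structure_tree hn hc hnc hI hL0 hR0 hL hR hw1 hw2 hAB.
subst E; have dim1 f : quasisymmetric f -> packing_dim (f @` moran_set n lo hi) = 1%E.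
  exact: quasisymmetric_image_dim1 T f hdim.
by split=> // f /dim1 ->; rewrite hdim.
Qed.
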